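(* Let $\beta\in(0,1]$. There exists a constant $C$ depending only on $\beta$ such that the following holds. Assume that $F_j(\cdot)\ge0$ for all $j=1,\dots,d$ and that there exists $u_n\ge1$ such that $\|b_j(X_1,\dots,X_r)\|_{\psi_\beta}\le u_n$ and $\|f_j(X_1,\dots,X_r)\|_{\psi_\beta}\le u_n$ for all $j=1,\dots,d$. Let $Z:=\max_{1\le j\le d}|I_{n,r}|^{-1}\sum_{\iota\in I_{n,r}}F_j(X_\iota,W_\iota)$. Then with probability at least $1-8/n$, $$Z\le C\max_{1\le j\le d}\mathbb{E}[f_j(X_1,\dots,X_r)]+Cn^{-1}r\log^{1/\beta+1}(dn)\log^{1/\beta-1}(n)\,u_n+C|I_{n,r}|^{-1}r^{3/\beta}\log^{2/\beta+1}(dn)\log^{2/\beta-1}(n)\,u_n.$$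
   Context: $n\ge4$, $d\ge3$, $2\le r\le n$ are integers. $X_1,\dots,X_n$ are i.i.d. random variables in a measurable space $(S,\mathcal{S})$; $I_{n,r}=\{\iota=(i_1,\dots,i_r):1\le i_1<\dots<i_r\le n\}$; $X_\iota=(X_{i_1},\dots,X_{i_r})$; $W,\{W_\iota:\iota\in I_{n,r}\}$ are i.i.d. random variables in a measurable space $(S',\mathcal{S}')$, independent of $X_1,\dots,X_n$. $F:S^r\times S'\to\mathbb{R}^d$ is measurable and symmetric in the first $r$ variables. Define $f(x_1,\dots,x_r):=\mathbb{E}[F(x_1,\dots,x_r,W)]$ and $b_j(x_1,\dots,x_r):=\|F_j(x_1,\dots,x_r,W)-f_j(x_1,\dots,x_r)\|_{\psi_\beta}$ for $j=1,\dots,d$. For a real random variable $\xi$, $\|\xi\|_{\psi_\beta}=\inf\{C>0:\mathbb{E}[e^{(|\xi|/C)^\beta}-1]\le1\}$. $\log^a(x)=(\log x)^a$. *)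

(* Defs.v *)
From mathcomp Require Import all_boot all_order all_algebra perm.
From mathcomp Require Import all_classical all_reals all_analysis.

Set Implicit Arguments.
Unset Strict Implicit.
Unset Printing Implicit Defensive.
Import Order.TTheory GRing.Theory Num.Theory.
Import numFieldNormedType.Exports.

Local Open Scope classical_set_scope.
Local Open Scope ring_scope.
Local Open Scope ereal_scope.

(* The index set I_{n,r}; its indices start at 0 instead of 1. *)
Definition inc_tuple (n r : nat) : predArgType :=
  {t : r.-tuple 'I_n | sorted ltn [seq val i | i <- t]}.

Section random_families.
Context dT (T : measurableType dT) (R : realType) (P : probability T R).
Context dS (S : measurableType dS).

Definition mutually_independent (I : finType) (X : I -> {RV P >-> S}) : Prop :=
  forall (J : {set I}) (A : I -> set S),
    (forall i, i \in J -> measurable (A i)) ->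
    P (\bigcap_(i in [set` J]) (X i @^-1` A i)) =
    \prod_(i in J) P (X i @^-1` A i).

Definition identically_distributed (I : Type) (X : I -> {RV P >-> S}) : Prop :=
  forall (i j : I) (A : set S), measurable A ->
    distribution P (X i) A = distribution P (X j) A.

Definition iid (I : finType) (X : I -> {RV P >-> S}) : Prop :=
  mutually_independent X /\ identically_distributed X.

(* The sigma-algebra on the sample space generated by a family. *)
Definition sigma_family (I : Type) (X : I -> {RV P >-> S}) : set (set T) :=
  <<s \bigcup_i preimage_set_system setT (X i) measurable >>.

End random_families.

Definition independent_families dT (T : measurableType dT) (R : realType)
    (P : probability T R) dS (S : measurableType dS)
    dS' (S' : measurableType dS') (I J : Type)
    (X : I -> {RV P >-> S}) (Y : J -> {RV P >-> S'}) : Prop :=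
  forall A B : set T, sigma_family X A -> sigma_family Y B ->
    P (A `&` B) = P A * P B.

(* Defined for extended real xi; it is +oo when no C is admissible. *)
Definition psi_norm dT (T : measurableType dT) (R : realType)
    (P : probability T R) (beta : R) (xi : T -> \bar R) : \bar R :=
  ereal_inf [set C%:E | C in [set C : R | (0 < C)%R /\
    \int[P]_w (expeR ((`|xi w| * (C^-1)%:E) `^ beta) - 1) <= 1]].

(* (X_{t_1}, ..., X_{t_r}) *)
Definition subfamily dT (T : measurableType dT) (R : realType)
    (P : probability T R) dS (S : measurableType dS) (n r : nat)
    (X : 'I_n -> {RV P >-> S}) (t : r.-tuple 'I_n) (w : T) : r.-tuple S :=
  [tuple X (tnth t k) w | k < r].

Definition first_indices (n r : nat) (hrn : (r <= n)%N) : r.-tuple 'I_n :=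
  [tuple widen_ord hrn k | k < r].

Definition symmetric_kernel (S S' E : Type) (r : nat)
    (F : r.-tuple S * S' -> E) : Prop :=
  forall (s : {perm 'I_r}) (x : r.-tuple S) (v : S'),
    F ([tuple tnth x (s k) | k < r], v) = F (x, v).

Section kernel.
Context dT (T : measurableType dT) (R : realType) (P : probability T R).
Context dS (S : measurableType dS) dS' (S' : measurableType dS') (r d : nat).
Variables (F : r.-tuple S * S' -> d.-tuple R).

(* Extended real valued: the expectation of a nonnegative F_j may be +oo. *)
Definition mean_kernel (W : {RV P >-> S'}) (j : 'I_d) (x : r.-tuple S) :
    \bar R :=
  'E_P[fun w => tnth (F (x, W w)) j].

Definition psi_kernel (beta : R) (W : {RV P >-> S'}) (j : 'I_d)
    (x : r.-tuple S) : \bar R :=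
  psi_norm P beta
    (fun w => (tnth (F (x, W w)) j)%:E - mean_kernel W j x).

Definition max_average (n : nat) (X : 'I_n -> {RV P >-> S})
    (Wi : inc_tuple n r -> {RV P >-> S'}) (w : T) : \bar R :=
  \big[maxe/-oo]_(j < d)
    (#|{: inc_tuple n r}|%:R^-1 *
     \sum_(i : inc_tuple n r)
       tnth (F (subfamily X (val i) w, Wi i w)) j)%R%:E.

End kernel.

(* Main.v *)
From HB Require Import structures.
From mathcomp Require Import fingroup action primitive_action alt.
From mathcomp Require Import ring lra zify.
Require Import Defs.
From mathcomp Require Import all_boot all_order all_algebra perm.
From mathcomp Require Import all_classical all_reals all_analysis.
From mathcomp Require Import measurable_realfun.

Set Implicit Arguments.
Unset Strict Implicit.
Unset Printing Implicit Defensive.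
Import Order.TTheory GRing.Theory Num.Theory.
Import numFieldNormedType.Exports.

(** Fix a coordinate [j], write [K] for [F_j], [I] for the set of increasing
    tuples, and put [L = ln (d n)].  The whole argument rests on one remark: for
    [0 <= Y <= B] one has [E exp ((Y - 2 E Y) / (2 B)) <= 1]
    ([bounded_mgf_le1]).  Comparing a sum of independent nonnegative variables
    with twice its mean therefore costs only a multiple of [B L], and no
    variance has to be estimated.  It remains to truncate, and to exhibit
    independence.

    Truncation.  The bound on [F_j - f_j] is conditional on [X], with a random
    Orlicz norm [b_j].  By the inequality of means,
      [(|K - f| / u)^(beta/2) <= ((|K - f| / b)^beta + (b / u)^beta) / 2]
    (up to a shift of [b] by [u]), so the conditional bound and the bounds on
    [b_j] and [f_j] merge into a single bound on the mean of
    [exp ((K / u)^(beta/2) / 4)] ([integral_expR_split]).  Let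
    [h = min (K, B0)] with [B0] of order [u L^(2/beta)], and [g x = E h (x, W)],
    which is at most [f x]; let [phi = min (g, B1)] with [B1] of order
    [u L^(1/beta)].  The means of the two excesses [K - h] and [g - phi] are then
    of order [u (d n)^-2] ([integral_excess_le]): small enough for Markov's
    inequality and a union over [j].

    Independence.  Conditionally on the [X_i], the variables [h (X_i, W_i)] are
    independent, with means [g (X_i)], so with high probability the average of [h]
    is at most twice the average of [g] plus [2 B0 L / |I|]
    ([conditional_mgf_le1]).  The average of
    [phi (X_i)] over increasing tuples is also the average, over all permutations
    of the indices, of the mean of [phi] over [n / r] disjoint blocks
    ([average_inc_tuple]); by convexity of the exponential its exponential moment
    is controlled by that of sums of [n / r] independent terms
    ([symmetric_average_mgf]), and this gives the term in [r / n].

    Each of these four estimates says that a nonnegative variable with mean at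
    most 1 does not exceed [d n].  Adding the four variables over all
    coordinates and applying Markov's inequality once ([markov_sum]), they all
    hold together outside an event of probability [4 d / (d n) = 4 / n]. *)

Local Open Scope classical_set_scope.
Local Open Scope ring_scope.
Local Open Scope ereal_scope.

(** * Independent systems of events *)

Section independence.
Context d (T : measurableType d) (R : realType) (P : probability T R).

Definition independent_systems (C1 C2 : set (set T)) :=
  forall A B, C1 A -> C2 B -> P (A `&` B) = P A * P B.

Lemma independent_systems_sym C1 C2 :
  independent_systems C1 C2 -> independent_systems C2 C1.
Proof. by move=> C12 A B ? ?; rewrite setIC muleC C12. Qed.

(** Dynkin's lemma: for fixed [B], the events [A] that are independent of [B]
    form a Dynkin system. *)
Lemma independent_sigma_l C1 C2 : C1 `<=` measurable -> C2 `<=` measurable ->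
  setI_closed C1 -> independent_systems C1 C2 ->
  independent_systems <<s C1 >> C2.
Proof.
move=> mC1 mC2 C1I C12 A B C1A C2B.
have mB := mC2 _ C2B.
pose H := [set A : set T | measurable A /\ P (A `&` B) = P A * P B].
suff: H A by case.
move: A C1A; rewrite -setI_closed_g_dynkin_g_sigma_algebra//.
apply: smallest_sub; last by move=> A CA; split; [exact: mC1|exact: C12].
split.
- by split=> //; rewrite setTI probability_setT mul1e.
- move=> A [mA AB]; split; first exact: measurableC.
  have -> : P (~` A `&` B) = P B - P (A `&` B).
    by rewrite setIC -setDE measureD ?[A `&` B]setIC// ltey_eq fin_num_measure.
  rewrite AB probability_setC// muleBl ?mul1e//.
  exact: fin_num_measure.
- move=> F tF HF; split; first by apply: bigcup_measurable => k _; case: (HF k).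
  have mF k : measurable (F k) by case: (HF k).
  rewrite setI_bigcupl measure_bigcup//=; last 2 first.
    by move=> k _; exact: measurableI.
    by apply: trivIset_setIr.
  rewrite measure_bigcup// muleC -[P B]fineK ?fin_num_measure// -nneseriesZl//=.
  rewrite fineK ?fin_num_measure//.
  by apply: eq_eseriesr => k _; have [_ ->] := HF k; rewrite muleC.
Qed.

Lemma independent_sigma C1 C2 : C1 `<=` measurable -> C2 `<=` measurable ->
  setI_closed C1 -> setI_closed C2 -> independent_systems C1 C2 ->
  independent_systems <<s C1 >> <<s C2 >>.
Proof.
move=> mC1 mC2 C1I C2I C12.
apply: independent_sigma_l => //.
  by apply: smallest_sub => //; exact: sigma_algebra_measurable.
apply/independent_systems_sym/independent_sigma_l => //.
exact/independent_systems_sym.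
Qed.

(** The joint law of two independent random elements is the product of their
    laws, so one may integrate over independent copies.  The targets [T1] and
    [T2] are arbitrary in order to cover the case where [Y1] and [Y2] are the
    identity towards two sub-sigma-algebras of [T]. *)
Lemma integral_independent_pair d1 (T1 : measurableType d1) d2
    (T2 : measurableType d2) (Y1 : T -> T1) (Y2 : T -> T2)
    (phi : T1 * T2 -> \bar R) :
  measurable_fun setT Y1 -> measurable_fun setT Y2 ->
  (forall A B, measurable A -> measurable B ->
    P (Y1 @^-1` A `&` Y2 @^-1` B) = P (Y1 @^-1` A) * P (Y2 @^-1` B)) ->
  measurable_fun setT phi -> (forall z, 0 <= phi z) ->
  \int[P]_w phi (Y1 w, Y2 w) = \int[P]_w \int[P]_w' phi (Y1 w, Y2 w').
Proof.
move=> m1 m2 Y12 mphi phi0.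
pose X1 : {mfun T >-> T1} := HB.pack Y1 (isMeasurableFun.Build _ _ _ _ _ m1).
pose X2 : {mfun T >-> T2} := HB.pack Y2 (isMeasurableFun.Build _ _ _ _ _ m2).
pose X12 : {mfun T >-> (T1 * T2)%type} := HB.pack (fun w => (Y1 w, Y2 w))
  (isMeasurableFun.Build _ _ _ _ _ (measurable_fun_pair m1 m2)).
rewrite -(@ge0_integral_distribution _ _ _ _ _ P X12 phi)//.
rewrite (eq_measure_integral (distribution P X1 \x distribution P X2)); last first.
  by move=> A mA _; apply/esym/product_measure_unique.
rewrite fubini_tonelli1//.
rewrite (@ge0_integral_distribution _ _ _ _ _ P X1)//; last 2 first.
- exact: measurable_fun_fubini_tonelli_F.
- by move=> x; apply: integral_ge0.
apply: eq_integral => w _ /=; rewrite /fubini_F.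
rewrite (@ge0_integral_distribution _ _ _ _ _ P X2)//.
exact: measurableT_comp.
Qed.

End independence.

(** * Functions of disjoint groups of independent variables *)

Section mutual_independence.
Context d (T : measurableType d) (R : realType) (P : probability T R).
Context dS (S : measurableType dS) (I : finType) (X : I -> {RV P >-> S}).

(** The pi-system of finite products of events, which generates the
    sigma-algebra of the variables with index in [J]. *)
Definition cylinders (J : {set I}) : set (set T) :=
  [set E | exists2 A : I -> set S, forall i, measurable (A i) &
    E = \bigcap_(i in [set` J]) (X i @^-1` A i)].

Lemma cylinders_measurable J : cylinders J `<=` measurable.
Proof.
move=> _ [A mA ->]; apply: fin_bigcap_measurable => // i _.
exact: measurable_funPTI.
Qed.

Lemma sigma_cylinders_measurable J : <<s cylinders J >> `<=` measurable.
Proof.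
apply: smallest_sub; first exact: sigma_algebra_measurable.
exact: cylinders_measurable.
Qed.

Lemma setI_closed_cylinders J : setI_closed (cylinders J).
Proof.
move=> _ _ [A mA ->] [B mB ->]; exists (fun i => A i `&` B i).
  by move=> i; exact: measurableI.
by rewrite -bigcapI; apply: eq_bigcapr => i _; rewrite preimage_setI.
Qed.

Lemma sub_cylinders (J K : {set I}) : J \subset K ->
  cylinders J `<=` cylinders K.
Proof.
move=> /fintype.subsetP JK _ [A mA ->].
exists (fun i => if i \in J then A i else setT).
  by move=> i; case: ifP.
apply/seteqP; split => w Aw i /= Ki.
  by case: ifPn => // iJ; exact: Aw.
by have := Aw i (JK _ Ki); rewrite Ki.
Qed.

Lemma preimage_cylinder (J : {set I}) i (B : set S) : i \in J -> measurable B ->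
  cylinders J (X i @^-1` B).
Proof.
move=> iJ mB; exists (fun j => if j == i then B else setT).
  by move=> j; case: ifP.
apply/seteqP; split => [w Bw j _ /=|w /(_ i iJ)/=]; last by rewrite eqxx.
by case: eqP => [->|].
Qed.

(** On cylinders this is the product rule for the index set [J :|: K]. *)
Lemma independent_cylinders (J K : {set I}) : mutually_independent X ->
  [disjoint J & K]%B ->
  independent_systems P <<s cylinders J >> <<s cylinders K >>.
Proof.
move=> indX JK; apply: independent_sigma; do ?exact: cylinders_measurable;
  do ?exact: setI_closed_cylinders.
move=> _ _ [A mA ->] [B mB ->].
pose C i := if i \in J then A i else B i.
have mC i : measurable (C i) by rewrite /C; case: ifP.
have CJ i : i \in J -> C i = A i by rewrite /C => ->.
have CK i : i \in K -> C i = B i.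
  by rewrite /C; case: ifPn => // iJ; rewrite (disjointFr JK iJ).
have EJ : \bigcap_(i in [set` J]) (X i @^-1` A i) =
    \bigcap_(i in [set` J]) (X i @^-1` C i).
  by apply: eq_bigcapr => i /= /CJ ->.
have EK : \bigcap_(i in [set` K]) (X i @^-1` B i) =
    \bigcap_(i in [set` K]) (X i @^-1` C i).
  by apply: eq_bigcapr => i /= /CK ->.
rewrite EJ EK -bigcap_setU.
have -> : [set` J] `|` [set` K] = [set` J :|: K].
  by apply/seteqP; split => i /=; rewrite inE => /orP.
by rewrite !indX//= -bigU//; apply: eq_bigl => i; rewrite inE.
Qed.

(** Measurability with respect to the sigma-algebra of the variables in [J],
    stated through preimages so that [T] keeps its own measurable structure. *)
Definition determined_by (J : {set I}) d' (T' : measurableType d')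
    (Y : T -> T') := forall B, measurable B -> <<s cylinders J >> (Y @^-1` B).

Lemma determined_byP J d' (T' : measurableType d') (Y : T -> T') :
  determined_by J Y <->
  @measurable_fun _ _ (g_sigma_algebraType (cylinders J)) T' setT Y.
Proof.
split => [YJ _ B mB|mY B mB]; first by rewrite setTI; exact: YJ.
by have := mY measurableT B mB; rewrite setTI.
Qed.

Lemma determined_by_comp J d' (T' : measurableType d') d'' (T'' : measurableType d'')
    (Y : T -> T') (f : T' -> T'') :
  measurable_fun setT f -> determined_by J Y -> determined_by J (f \o Y).
Proof.
by move=> mf /determined_byP mY; apply/determined_byP; exact: measurableT_comp.
Qed.

Lemma determined_by_sub (J K : {set I}) d' (T' : measurableType d') (Y : T -> T') :
  J \subset K -> determined_by J Y -> determined_by K Y.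
Proof.
move=> JK YJ B mB; have := YJ B mB.
by apply: sub_sigma_algebra2 => //; exact: sub_cylinders.
Qed.

Lemma determined_by_var (J : {set I}) i : i \in J -> determined_by J (X i).
Proof.
by move=> iJ B mB; apply: sub_sigma_algebra; exact: preimage_cylinder.
Qed.

Lemma determined_by_prod (L : eqType) (s : seq L) J (Y : L -> T -> R) :
  {in s, forall l, determined_by J (Y l)} ->
  determined_by J (fun w => \prod_(l <- s) Y l w)%R.
Proof.
move=> YJ; apply/determined_byP.
elim: s YJ => [|l s IH] YJ.
  by under eq_fun do rewrite big_nil; exact: measurable_cst.
under eq_fun do rewrite big_cons.
apply: measurable_funM.
  by move/determined_byP: (YJ l (mem_head l s)).
by apply: IH => m ms; apply: YJ; rewrite in_cons ms orbT.
Qed.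

Lemma determined_by_measurable J d' (T' : measurableType d') (Y : T -> T') :
  determined_by J Y -> measurable_fun setT Y.
Proof.
by move=> YJ _ B mB; rewrite setTI; apply: sigma_cylinders_measurable; exact: YJ.
Qed.

Lemma integral_mul_groups (J K : {set I}) (Y Z : T -> R) :
  mutually_independent X -> [disjoint J & K]%B ->
  determined_by J Y -> determined_by K Z ->
  (forall w, 0 <= Y w)%R -> (forall w, 0 <= Z w)%R ->
  \int[P]_w (Y w * Z w)%:E = \int[P]_w (Y w)%:E * \int[P]_w (Z w)%:E.
Proof.
move=> indX JK YJ ZK Y0 Z0.
have mY := determined_by_measurable YJ; have mZ := determined_by_measurable ZK.
(* absolute values make the integrand nonnegative on the whole plane *)
have := @integral_independent_pair _ _ _ P _ R _ R Y Z
  (fun z => (`|z.1| * `|z.2|)%:E) mY mZ.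
move=> /= H.
transitivity (\int[P]_w (`|Y w| * `|Z w|)%:E).
  by apply: eq_integral => w _; rewrite !ger0_norm.
rewrite H; first last.
- by move=> z; rewrite lee_fin mulr_ge0.
- apply/measurable_EFinP; apply: measurable_funM;
    by apply: measurableT_comp => //; exact: normr_measurable.
- by move=> A B mA mB; apply: (independent_cylinders indX JK); [exact: YJ|exact: ZK].
under eq_integral => w _ do under eq_integral => w' _ do rewrite EFinM.
under eq_integral => w _.
  rewrite ge0_integralZl//; last by apply/measurable_EFinP; exact: measurableT_comp.
  over.
rewrite /= ge0_integralZr//; last 2 first.
- by apply/measurable_EFinP; exact: measurableT_comp.
- exact: integral_ge0.
by congr (_ * _); apply: eq_integral => w _; rewrite ger0_norm.
Qed.

Lemma integral_prod_groups (L : eqType) (s : seq L) (J : L -> {set I})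
    (Y : L -> T -> R) :
  mutually_independent X -> uniq s ->
  {in s &, forall l m, l != m -> [disjoint J l & J m]%B} ->
  (forall l, determined_by (J l) (Y l)) ->
  (forall l w, 0 <= Y l w)%R ->
  \int[P]_w (\prod_(l <- s) Y l w)%:E = \prod_(l <- s) \int[P]_w (Y l w)%:E.
Proof.
move=> indX + + YJ Y0; elim: s => [|l s IH] us dJ.
  under eq_integral do rewrite big_nil.
  by rewrite big_nil integral_cst// mul1e; exact: probability_setT.
move: us => /= /andP[ls us].
rewrite big_cons -IH//; last first.
  by move=> m p ms ps; apply: dJ; rewrite in_cons ?ms ?ps orbT.
pose K := (\bigcup_(m <- s) J m)%SET.
rewrite -(@integral_mul_groups (J l) K)//.
- by apply: eq_integral => w _; rewrite big_cons.
- rewrite /K big_seq disjoint_sym.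
  apply: (big_ind (fun A : {set I} => [disjoint A & J l]%B)) => [|A B AJ BJ|m ms].
  - by rewrite finset.disjoints_subset finset.sub0set.
  - by rewrite finset.disjoints_subset finset.subUset -!finset.disjoints_subset AJ.
  apply: dJ; rewrite ?in_cons ?ms ?eqxx ?orbT//.
  by apply: contraNneq ls => <-.
- apply: determined_by_prod => m ms; apply: determined_by_sub (YJ m).
  by rewrite /K (big_rem m)//= finset.subsetUl.
- by move=> w; apply: prodr_ge0 => m _.
Qed.

End mutual_independence.

(** * The law of a tuple of variables *)

Section tuple_law.
Context dS (S : measurableType dS) (r : nat).

Definition boxes : set (set (r.-tuple S)) :=
  [set E | exists2 A : 'I_r -> set S, forall k, measurable (A k) &
    E = [set x | forall k, A k (tnth x k)]].

(** The inclusion of the product sigma-algebra in the one generated by boxes is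
    the measurability of the identity from the latter, which is checked on
    coordinates. *)
Lemma measurable_boxesE : measurable = <<s boxes >>.
Proof.
apply/seteqP; split => [E mE|].
  have : @measurable_fun _ _ (g_sigma_algebraType boxes) (r.-tuple S) setT id.
    apply/measurable_fun_tnthP => i _ B mB; rewrite setTI.
    apply: sub_sigma_algebra; exists (fun k => if k == i then B else setT).
      by move=> k; case: ifP.
    apply/seteqP; split => x /=; last by move=> /(_ i); rewrite eqxx.
    by move=> Bx k; case: eqP => [->|].
  by move=> /(_ measurableT E mE); rewrite setTI.
apply: smallest_sub; first exact: sigma_algebra_measurable.
move=> _ [A mA ->].
rewrite (_ : mkset _ = \bigcap_(k in [set: 'I_r]) ((fun x => tnth x k) @^-1` A k)).
  apply: fin_bigcap_measurable => // k _.
  by rewrite -[X in measurable X]setTI; exact: measurable_tnth.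
by apply/seteqP; split => x /= H k; [move=> _; exact: H|exact: (H k I)].
Qed.

Lemma setI_closed_boxes : setI_closed boxes.
Proof.
move=> _ _ [A mA ->] [B mB ->]; exists (fun k => A k `&` B k).
  by move=> k; exact: measurableI.
apply/seteqP; split => x /=; first by move=> [Ax Bx] k; split.
by move=> H; split => k; have [] := H k.
Qed.

End tuple_law.

Section subfamilies.
Context dT (T : measurableType dT) (R : realType) (P : probability T R).
Context dS (S : measurableType dS) (n r : nat) (X : 'I_n -> {RV P >-> S}).
Implicit Types t u : r.-tuple 'I_n.

Lemma measurable_subfamily t : measurable_fun setT (subfamily X t).
Proof.
apply/measurable_fun_tnthP => k.
by rewrite (_ : _ \o _ = X (tnth t k))//; apply/funext => w; rewrite /= tnth_mktuple.
Qed.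

Lemma determined_by_subfamily t :
  determined_by X [set i in t]%SET (subfamily X t).
Proof.
apply/determined_byP/measurable_fun_tnthP => k.
rewrite (_ : _ \o _ = X (tnth t k)); last first.
  by apply/funext => w; rewrite /= tnth_mktuple.
apply/(determined_byP X); apply: determined_by_var.
by rewrite inE mem_tnth.
Qed.

Lemma sigma_family_subfamily t (A : set (r.-tuple S)) : measurable A ->
  sigma_family X (subfamily X t @^-1` A).
Proof.
move=> mA.
set G := \bigcup_i preimage_set_system setT (X i) measurable.
have : @measurable_fun _ _ (g_sigma_algebraType G) (r.-tuple S) setT (subfamily X t).
  apply/measurable_fun_tnthP => k.
  rewrite (_ : _ \o _ = X (tnth t k)); last first.
    by apply/funext => w; rewrite /= tnth_mktuple.
  move=> _ B mB; apply: sub_sigma_algebra; exists (tnth t k) => //.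
  by exists B.
by move=> /(_ measurableT A mA); rewrite setTI.
Qed.

(** The product rule speaks of sets of indices; injectivity of [tnth t] turns
    the condition on coordinates into one condition [B i] per index [i]. *)
Lemma probability_box t (A : 'I_r -> set S) : mutually_independent X -> uniq t ->
  (forall k, measurable (A k)) ->
  P (subfamily X t @^-1` [set x | forall k, A k (tnth x k)]) =
  \prod_(k < r) P (X (tnth t k) @^-1` A k).
Proof.
move=> indX ut mA.
have tinj : injective (tnth t) by exact/tuple_uniqP.
pose B i := if [pick k | tnth t k == i] is Some k then A k else setT.
have mB i : measurable (B i) by rewrite /B; case: pickP.
have BE k : B (tnth t k) = A k.
  by rewrite /B; case: pickP => [l /eqP/tinj ->//|/(_ k)]; rewrite eqxx.
have := indX [set tnth t k | k in 'I_r]%SET B (fun i _ => mB i).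
rewrite big_imset/=; last by move=> k l _ _; exact: tinj.
under eq_bigr do rewrite BE.
move=> <-; congr (P _); apply/seteqP; split => w /= H.
  move=> i /= /imsetP[k _ ->]; have := H k.
  by rewrite tnth_mktuple BE.
move=> k; rewrite tnth_mktuple -BE; apply: H => /=; exact: imset_f.
Qed.

(** The law of a tuple of distinct variables of an i.i.d. family does not
    depend on the indices, because it does not on boxes. *)
Lemma integral_subfamily t u (psi : r.-tuple S -> \bar R) : iid X ->
  uniq t -> uniq u -> measurable_fun setT psi -> (forall x, 0 <= psi x) ->
  \int[P]_w psi (subfamily X t w) = \int[P]_w psi (subfamily X u w).
Proof.
move=> [indX idX] ut uu mpsi psi0.
pose V v : {mfun T >-> r.-tuple S} := HB.pack (subfamily X v)
  (isMeasurableFun.Build _ _ _ _ _ (measurable_subfamily v)).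
have VE v : \int[P]_w psi (subfamily X v w) = \int[distribution P (V v)]_x psi x.
  by rewrite ge0_integral_distribution.
rewrite !VE; apply: eq_measure_integral => A mA _.
apply: (measure_unique (@boxes _ S r) (fun=> setT)) => //.
- exact: measurable_boxesE.
- exact: setI_closed_boxes.
- by move=> _; exists (fun=> setT) => //; apply/seteqP; split.
- exact: bigcup_const.
- move=> _ [B mB ->].
  transitivity (\prod_(k < r) P (X (tnth t k) @^-1` B k)).
    exact: probability_box.
  transitivity (\prod_(k < r) P (X (tnth u k) @^-1` B k)).
    by apply: eq_bigr => k _; exact: idX.
  by symmetry; exact: probability_box.
- by move=> _; rewrite -ge0_fin_numE// fin_num_measure.
Qed.

Lemma integral_independent_families dS' (S' : measurableType dS') (J : Type)
    (V : J -> {RV P >-> S'}) t (j : J) (psi : r.-tuple S * S' -> \bar R) :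
  independent_families X V -> measurable_fun setT psi -> (forall z, 0 <= psi z) ->
  \int[P]_w psi (subfamily X t w, V j w) =
  \int[P]_w \int[P]_w' psi (subfamily X t w, V j w').
Proof.
move=> XV mpsi psi0; apply: integral_independent_pair => //.
- exact: measurable_subfamily.
- move=> A B mA mB; apply: XV; first exact: sigma_family_subfamily.
  by apply: sub_sigma_algebra; exists j => //; exists B => //; rewrite setTI.
Qed.

End subfamilies.

(** * Integrals of kernels *)

Section kernel_integrals.
Context dT (T : measurableType dT) (R : realType) (P : probability T R).
Context dS (S : measurableType dS) dS' (S' : measurableType dS').

Lemma measurable_kernel_integral (psi : S * S' -> \bar R) (V : {RV P >-> S'}) :
  measurable_fun setT psi -> (forall z, 0 <= psi z) ->
  measurable_fun setT (fun x => \int[P]_w psi (x, V w)).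
Proof.
move=> mpsi psi0; pose f (z : S * T) := psi (z.1, V z.2).
have mf : measurable_fun setT f.
  apply: (measurableT_comp mpsi); apply: measurable_fun_pair => //.
  exact: measurableT_comp.
exact: (measurable_fun_fubini_tonelli_F (m2 := P) f mf (fun z => psi0 _)).
Qed.

Lemma integral_identically_distributed (J : Type) (V : J -> {RV P >-> S'}) i j
    (psi : S' -> \bar R) : identically_distributed V ->
  measurable_fun setT psi -> (forall x, 0 <= psi x) ->
  \int[P]_w psi (V i w) = \int[P]_w psi (V j w).
Proof.
move=> idV mpsi psi0.
have VE k : \int[P]_w psi (V k w) = \int[distribution P (V k)]_x psi x.
  by rewrite ge0_integral_distribution.
by rewrite !VE; apply: eq_measure_integral => A mA _; exact: idV.
Qed.

End kernel_integrals.


(** * Averages over increasing tuples and over permutations *)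

Section permutation_average.
Context (R : realType) (n r : nat).
Implicit Types (t : r.-tuple 'I_n) (s : {perm 'I_n}).

Definition perm_tuple s t : r.-tuple 'I_n := [tuple of map s t].

Lemma inc_tuple_uniq (t : inc_tuple n r) : uniq (val t).
Proof.
by have := valP t; rewrite ltn_sorted_uniq_leq => /andP[/map_uniq].
Qed.

Lemma perm_eq_inc_tuple (t u : inc_tuple n r) :
  perm_eq (val t) (val u) -> t = u.
Proof.
move=> tu; apply/val_inj/val_inj/(inj_map val_inj)/irr_sorted_eq.
- exact: ltn_trans.
- exact: ltnn.
- exact: valP t.
- exact: valP u.
- by move=> i; apply/perm_mem/perm_map.
Qed.

Definition sort_ord (x : seq 'I_n) := sort (fun i j : 'I_n => (i <= j)%N) x.

Lemma sorted_sort_perm s (t : inc_tuple n r) :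
  sorted ltn [seq val i | i <- [tuple of sort_ord (perm_tuple s (val t))]].
Proof.
rewrite ltn_sorted_uniq_leq (map_inj_uniq val_inj) sort_uniq.
rewrite (map_inj_uniq (@perm_inj _ s)) inc_tuple_uniq/= sorted_map.
by apply: sort_sorted => i j; exact: leq_total.
Qed.

Definition sort_perm s (t : inc_tuple n r) : inc_tuple n r :=
  Sub [tuple of sort_ord (perm_tuple s (val t))] (sorted_sort_perm s t).

Lemma sort_perm_inj s : injective (sort_perm s).
Proof.
move=> t u tu; apply: perm_eq_inc_tuple.
suff: perm_eq (perm_tuple s (val t)) (perm_tuple s (val u)).
  by move=> /(perm_map (s^-1)%g); rewrite -!map_comp !(eq_map (permK s)) !map_id.
have H x : perm_eql (sort_ord x) x by exact: perm_sort.
have E : sort_ord (perm_tuple s (val t)) = sort_ord (perm_tuple s (val u)).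
  exact: (congr1 (fun v : inc_tuple n r => val (val v)) tu).
by rewrite -(H (perm_tuple s (val t))) E H.
Qed.

(** The symmetric group acts transitively on tuples of distinct elements. *)
Lemma uniq_perm_tuple t (u : r.-tuple 'I_n) : uniq t -> uniq u ->
  exists s, u = perm_tuple s t.
Proof.
move=> ut uu.
have rn : (r <= #|'I_n|)%N by rewrite -{1}(size_tuple t) -(card_uniqP ut) max_card.
have dtuple (v : r.-tuple 'I_n) : uniq v -> v \in r.-dtuple([set: 'I_n]%SET).
  by move=> uv; rewrite inE uv; apply/fintype.subsetP => i _; rewrite finset.in_setT.
have tr := ntransitive_weak rn (@Sym_trans 'I_n).
have := atransP tr _ (dtuple t ut) => /setP /(_ u).
by rewrite dtuple// => /orbitP[s _ <-]; exists s.
Qed.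

(** Summing [phi] over the images of a tuple [u] under all permutations does not
    depend on [u], by transitivity.  Summing this over the increasing [u] and
    exchanging the sums gives the identity, since a permutation followed by
    sorting permutes the increasing tuples. *)
Lemma average_inc_tuple (phi : r.-tuple 'I_n -> R) t :
  (forall u v : r.-tuple 'I_n, perm_eq u v -> phi u = phi v) -> uniq t ->
  (#|{: inc_tuple n r}|%:R * \sum_(s : {perm 'I_n}) phi (perm_tuple s t) =
   n`!%:R * \sum_(u : inc_tuple n r) phi (val u))%R.
Proof.
move=> sphi ut.
have sumE (u : r.-tuple 'I_n) : uniq u ->
    (\sum_s phi (perm_tuple s u) = \sum_s phi (perm_tuple s t))%R.
  move=> uu; have [v ->] := uniq_perm_tuple ut uu.
  rewrite [RHS](reindex_inj (mulgI v)); apply: eq_bigr => s _; congr phi.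
  by apply: eq_from_tnth => k; rewrite !tnth_map permM.
transitivity (\sum_(u : inc_tuple n r) \sum_s phi (perm_tuple s (val u)))%R.
  under [RHS]eq_bigr => u _ do rewrite (sumE (val u) (inc_tuple_uniq u)).
  by rewrite [RHS]sumr_const mulr_natl.
rewrite exchange_big/=.
under eq_bigr => s _.
  have -> : (\sum_(u : inc_tuple n r) phi (perm_tuple s (val u)) =
      \sum_(u : inc_tuple n r) phi (val u))%R.
    rewrite [RHS](reindex_inj (@sort_perm_inj s)); apply: eq_bigr => u _.
    by apply: sphi; rewrite perm_sym; apply/permPl/perm_sort.
  over.
by rewrite sumr_const mulr_natl card_Sn.
Qed.

End permutation_average.

(** * Exponential inequalities on the reals *)

Section exponential_inequalities.
Context (R : realType).
Local Open Scope ring_scope.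
Implicit Types x y : R.

(** From [1 - y / 2 <= exp (- y / 2)] and [1 <= (1 + y) (1 - y / 2)]; the factor
    one half avoids any estimate of [exp 1]. *)
Lemma expR_half_le1D y : 0 <= y <= 1 -> expR (y / 2) <= 1 + y.
Proof.
move=> /andP[y0 y1].
have h : 1 - y / 2 <= expR (- (y / 2)) by exact: expR_ge1Dx.
have : expR (y / 2) * (1 - y / 2) <= 1.
  by rewrite -[leRHS](expRxMexpNx_1 (y / 2)) ler_wpM2l// expR_ge0.
have : 0 <= expR (y / 2) by exact: expR_ge0.
nra.
Qed.

(** Jensen's inequality, from the tangent of the exponential at the mean. *)
Lemma expR_average (J : finType) (y : J -> R) : (0 < #|J|)%N ->
  expR (#|J|%:R^-1 * \sum_j y j) <= #|J|%:R^-1 * \sum_j expR (y j).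
Proof.
move=> J0; set N := #|J|%:R; set m := _ * \sum_j y j.
have N0 : N != 0 :> R by rewrite pnatr_eq0 -lt0n.
have sumE : \sum_j (1 + (y j - m)) = N.
  rewrite big_split/= sumrB !sumr_const -[m *+ _]mulr_natl -/N.
  by rewrite /m mulrA divff// mul1r subrr addr0.
have -> : expR m = N^-1 * \sum_j expR m * (1 + (y j - m)).
  by rewrite -mulr_sumr sumE mulrCA mulVf// mulr1.
rewrite ler_wpM2l ?invr_ge0 ?ler0n// ler_sum// => j _.
rewrite -{2}(subrK m (y j)) expRD mulrC ler_wpM2r ?expR_ge0//.
exact: expR_ge1Dx.
Qed.

(** A power of [x] in the exponent beats [x]: take logarithms and use
    [ln z <= z] with [z = a g x^g]. *)
Lemma powR_le_expR (a g x : R) : 0 < a -> 0 < g -> 0 <= x ->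
  x <= (a * g) `^ (- g^-1) * expR (a * x `^ g).
Proof.
move=> a0 g0; rewrite le_eqVlt => /predU1P[<-|x0].
  by rewrite mulr_ge0 ?powR_ge0 ?expR_ge0.
have ag0 : 0 < a * g by rewrite mulr_gt0.
have xg0 : 0 < x `^ g by exact: powR_gt0.
have -> : (a * g) `^ (- g^-1) = expR (- g^-1 * ln (a * g)).
  by rewrite /powR gt_eqF.
rewrite -expRD -[leLHS](@lnK _ x)// ler_expR.
have H : ln (a * g * x `^ g) <= a * g * x `^ g.
  by apply/ltW/ln_sublinear/mulr_gt0.
move: H; rewrite lnM ?posrE// ln_powR => H.
rewrite -(ler_pM2l g0).
have -> : g * (- g^-1 * ln (a * g) + a * x `^ g) =
    - ln (a * g) + a * g * x `^ g by field; rewrite gt_eqF.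
lra.
Qed.

(** Above [B], half of the exponent absorbs the factor [y] through
    [powR_le_expR], and the other half is at least its value at [B]. *)
Lemma excess_le_expR (c g u B y : R) : 0 < c -> 0 < g -> 0 < u -> 0 <= B ->
  0 <= y ->
  Num.max (y - B) 0 <= (c / 2 * g) `^ (- g^-1) * u *
    expR (- (c / 2 * (B / u) `^ g)) * expR (c * (y / u) `^ g).
Proof.
move=> c0 g0 u0 B0 y0.
rewrite ge_max; apply/andP; split; last first.
  by rewrite !mulr_ge0 ?powR_ge0 ?expR_ge0 ?ltW.
have [yB|By] := leP y B.
  by apply: (@le_trans _ _ 0); rewrite ?subr_le0// !mulr_ge0 ?powR_ge0 ?expR_ge0 ?ltW.
apply: (@le_trans _ _ y); first by rewrite gerBl.
have yu0 : 0 <= y / u by rewrite divr_ge0 // ltW.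
have c20 : 0 < c / 2 by rewrite divr_gt0.
have := powR_le_expR c20 g0 yu0.
rewrite ler_pdivrMr// => /le_trans; apply.
rewrite -!mulrA ler_wpM2l ?powR_ge0// mulrC ler_pM2l// -expRD ler_expR.
have : (B / u) `^ g <= (y / u) `^ g.
  apply: ge0_ler_powR; rewrite ?nnegrE ?(ltW g0) ?divr_ge0 ?(ltW u0)//.
  by rewrite ler_pM2r ?invr_gt0// ltW.
nra.
Qed.

Lemma powRD_le (p x y : R) : 0 <= p <= 1 -> 0 <= x -> 0 <= y ->
  (x + y) `^ p <= 2 * (x `^ p + y `^ p).
Proof.
move=> /andP[p0 p1].
wlog xy : x y / x <= y => [H x0 y0|x0 y0].
  have [/H|/ltW/H] := leP x y; first exact.
  by rewrite addrC (addrC (y `^ p)); exact.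
apply: (@le_trans _ _ ((2 * y) `^ p)).
  by apply: ge0_ler_powR; rewrite ?nnegrE ?addr_ge0 ?mulr_ge0//; lra.
rewrite powRM// ler_pM ?powR_ge0//; last by rewrite lerDr powR_ge0.
by rewrite ler1_powR// ler1n.
Qed.

Lemma powR_half_mean (beta x y : R) : 0 < beta -> 0 <= x -> 0 <= y ->
  (x * y) `^ (beta / 2) <= 2^-1 * (x `^ beta + y `^ beta).
Proof.
move=> b0 x0 y0; rewrite powRM//.
have sq z : 0 <= z -> z `^ beta = (z `^ (beta / 2)) ^+ 2.
  by move=> z0; rewrite -powR_mulrn ?powR_ge0// -powRrM divfK.
rewrite !sq//; have := sqr_ge0 (x `^ (beta / 2) - y `^ (beta / 2)).
nra.
Qed.

(** Here [f] is a conditional mean, [G] the deviation from it and [b] its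
    conditional Orlicz norm.  Write
    [G / u = (G / (b + u)) ((b + u) / u)] and apply [powR_half_mean]: the exponent
    splits into the [beta]-powers of [f / u], [G / (b + u)] and [b / u], and
    Jensen's inequality separates the exponentials.  The scale [b + u] replaces
    [b] because it is positive and lies strictly above the norm. *)
Lemma expR_split (beta f G b u x : R) : 0 < beta <= 1 -> 0 < u ->
  0 <= f -> 0 <= G -> 0 <= b -> 0 <= x -> x <= f + G ->
  expR (4^-1 * (x / u) `^ (beta / 2)) <=
  expR 1 / 4 * (expR ((f / u) `^ beta) + expR ((G / (b + u)) `^ beta)
     + 2 * expR ((b / u) `^ beta)).
Proof.
move=> /andP[b0 b1] u0 f0 G0 bb0 x0 xfG.
have C0 : 0 < b + u by rewrite ltr_wpDl.
have p01 : 0 <= beta / 2 <= 1 by lra.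
have fu0 : 0 <= f / u by rewrite divr_ge0 // ltW.
have Gu0 : 0 <= G / u by rewrite divr_ge0 // ltW.
have bu0 : 0 <= b / u by rewrite divr_ge0 // ltW.
have GC0 : 0 <= G / (b + u) by rewrite divr_ge0 // ltW.
have h1 : (x / u) `^ (beta / 2) <= (f / u + G / u) `^ (beta / 2).
  apply: ge0_ler_powR; rewrite ?nnegrE ?addr_ge0 ?divr_ge0 ?(ltW u0) ?(ltW b0)//.
  by rewrite -mulrDl ler_wpM2r// invr_ge0 ltW.
have h2 := powRD_le p01 fu0 Gu0.
have h3 := powR_half_mean b0 fu0 (@ler01 R).
rewrite mulr1 powR1 in h3.
have Cu0 : 0 <= b / u + 1 by rewrite addr_ge0.
have h4 := powR_half_mean b0 GC0 Cu0.
rewrite (_ : G / (b + u) * (b / u + 1) = G / u) in h4; last first.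
  by field; rewrite !gt_eqF.
have h5 : (b / u + 1) `^ beta <= 2 * ((b / u) `^ beta + 1 `^ beta).
  by apply: powRD_le => //; rewrite (ltW b0).
rewrite powR1 in h5.
set Y := (x / u) `^ _ in h1 *.
set A := (f / u) `^ beta in h3 *; set D := (G / (b + u)) `^ beta in h4 *.
set E := (b / u) `^ beta in h5 *.
have hY : Y <= 3 + A + D + 2 * E by lra.
clearbody Y A D E; clear -hY.
(* the summand E counts twice, so that the four weights are all 1/4 *)
pose y (i : 'I_4) := nth 0 [:: A; D; E; E] i.
have := @expR_average _ y; rewrite card_ord => /(_ isT).
rewrite !big_ord_recl !big_ord0 /= /y /= => H.
have H4 : expR (4^-1 * Y) <= expR 1 * expR (4^-1 * (A + (D + (E + (E + 0))))).
  by rewrite -expRD ler_expR; lra.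
apply: (le_trans H4).
rewrite -[leRHS]mulrA ler_wpM2l ?expR_ge0//.
by apply: (le_trans H); lra.
Qed.

End exponential_inequalities.

(** * Orlicz norms *)

Section orlicz.
Context (R : realType).
Implicit Types (beta c : R) (x y : \bar R).

(** [psi_norm] is the infimum of the [c] for which the mean of [orlicz beta c]
    is at most 2; its admissibility condition subtracts 1 from this function. *)
Definition orlicz beta c x : \bar R := expeR ((`|x| * (c^-1)%:E) `^ beta).

Lemma orlicz_EFin beta c (a : R) :
  orlicz beta c a%:E = (expR ((`|a| / c) `^ beta))%:E.
Proof. by []. Qed.

Lemma orlicz_ge0 beta c x : 0 <= orlicz beta c x.
Proof. exact: expeR_ge0. Qed.

Lemma orlicz_ge1 beta c x : 1 <= orlicz beta c x.
Proof.
apply: le_trans (expeR_ge1Dx _); rewrite leeDl//; exact: poweR_ge0.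
Qed.

Lemma orlicz_pinfty beta c : (0 < beta)%R -> (0 < c)%R ->
  orlicz beta c +oo = +oo.
Proof.
by move=> b0 c0; rewrite /orlicz /= gt0_mulye ?lte_fin ?invr_gt0// poweRyr// gt_eqF.
Qed.

Lemma le_orlicz beta c x y : (0 <= beta)%R -> (0 < c)%R -> `|x| <= `|y| ->
  orlicz beta c x <= orlicz beta c y.
Proof.
move=> b0 c0 xy; rewrite /orlicz lee_expeR; apply: gt0_ler_poweR => //.
- by rewrite in_itv/= leey andbT mule_ge0// lee_fin invr_ge0 ltW.
- by rewrite in_itv/= leey andbT mule_ge0// lee_fin invr_ge0 ltW.
- by rewrite lee_wpmul2r// lee_fin invr_ge0 ltW.
Qed.

Lemma le_orlicz_scale beta c c' x : (0 <= beta)%R -> (0 < c')%R -> (c' <= c)%R ->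
  orlicz beta c x <= orlicz beta c' x.
Proof.
move=> b0 c0 cc; rewrite /orlicz lee_expeR; apply: gt0_ler_poweR => //.
- by rewrite in_itv/= leey andbT mule_ge0// lee_fin invr_ge0 ltW// (lt_le_trans c0).
- by rewrite in_itv/= leey andbT mule_ge0// lee_fin invr_ge0 ltW.
- by rewrite lee_wpmul2l// lee_fin lef_pV2 ?posrE// (lt_le_trans c0).
Qed.

Lemma measurable_expeR : measurable_fun [set: \bar R] (@expeR R).
Proof.
rewrite (_ : @expeR R = fun x => maxe (er_map expR x) 0); last first.
  apply/funext => -[a| |] /=.
  - by apply/esym/max_l; rewrite lee_fin expR_ge0.
  - by apply/esym/max_l; exact: leey.
  - by apply/esym/max_r; exact: leNye.
apply: measurable_maxe; last exact: measurable_cst.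
by apply: (@measurable_er_map _ R); exact: measurable_expR.
Qed.

Lemma measurable_orlicz beta c : measurable_fun [set: \bar R] (orlicz beta c).
Proof.
apply: measurableT_comp; first exact: measurable_expeR.
have m1 : measurable_fun [set: \bar R] (fun x => `|x| * (c^-1)%:E).
  by under eq_fun do rewrite muleC; exact/measurable_funeM/abse_measurable.
exact: (measurableT_comp (measurable_poweR beta) m1).
Qed.

Lemma measurable_expR_powR (c u p : R) :
  measurable_fun setT (fun a : R => expR (c * (a / u) `^ p)%R).
Proof.
have m1 : measurable_fun setT (fun a : R => a / u)%R.
  by apply: measurable_funM => //; exact: measurable_cst.
have m2 : measurable_fun setT (fun a : R => c * (a / u) `^ p)%R.
  apply: measurable_funM; first exact: measurable_cst.
  exact: (measurableT_comp (@measurable_powR R p) m1).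
exact: (measurableT_comp (@measurable_expR R) m2).
Qed.

Context d (T : measurableType d) (P : probability T R).

Lemma integral_probability_cst (a : \bar R) : \int[P]_w a = a.
Proof.
rewrite -[RHS]mule1 -(@probability_setT _ _ _ P).
exact: (@integral_cst _ _ _ P setT measurableT a).
Qed.

Lemma psi_norm_ge0 beta (xi : T -> \bar R) : 0 <= psi_norm P beta xi.
Proof. by apply: le_ereal_inf_tmp => _ [c [c0 _] <-]; rewrite lee_fin ltW. Qed.

Lemma integral_orliczB1 beta c (xi : T -> \bar R) : measurable_fun setT xi ->
  \int[P]_w orlicz beta c (xi w) = \int[P]_w (orlicz beta c (xi w) - 1) + 1.
Proof.
move=> mxi.
have mo : measurable_fun setT (fun w => orlicz beta c (xi w)).
  by apply: measurableT_comp => //; exact: measurable_orlicz.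
transitivity (\int[P]_w ((orlicz beta c (xi w) - 1) + cst 1 w)).
  by apply: eq_integral => w _; rewrite subeK.
rewrite ge0_integralD//; first by rewrite (integral_probability_cst 1).
- by move=> w _; rewrite sube_ge0 ?orlicz_ge1.
- by apply: emeasurable_funB => //; exact: measurable_cst.
Qed.

(** The admissible scales are upward closed. *)
Lemma psi_norm_lt beta c (xi : T -> \bar R) : (0 <= beta)%R ->
  measurable_fun setT xi -> psi_norm P beta xi < c%:E ->
  \int[P]_w (orlicz beta c (xi w) - 1) <= 1.
Proof.
move=> b0 mxi /ereal_inf_lt[_ [c' [c'0 H] <-]]; rewrite lte_fin => cc.
apply: le_trans H; apply: ge0_le_integral => //.
- by move=> w _; rewrite sube_ge0 ?orlicz_ge1.
- apply: emeasurable_funB; last exact: measurable_cst.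
  by apply: measurableT_comp => //; exact: measurable_orlicz.
- apply: emeasurable_funB; last exact: measurable_cst.
  by apply: (measurableT_comp (measurable_orlicz beta c')).
- by move=> w _; rewrite leeB// le_orlicz_scale// ltW.
Qed.

Lemma psi_norm_lt_orlicz beta c (xi : T -> \bar R) : (0 <= beta)%R ->
  measurable_fun setT xi -> psi_norm P beta xi < c%:E ->
  \int[P]_w orlicz beta c (xi w) <= 2.
Proof.
move=> b0 mxi /(psi_norm_lt b0 mxi) H.
by rewrite integral_orliczB1// (_ : 2 = 1 + 1)//; exact: leeD.
Qed.

(** The norm is below [a] exactly when some rational scale below [a] is
    admissible, and each admissibility condition is measurable by Tonelli's
    theorem. *)
Lemma measurable_psi_norm beta d' (S : measurableType d') (xi : S * T -> \bar R) :
  (0 <= beta)%R -> measurable_fun setT xi ->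
  measurable_fun setT (fun s => psi_norm P beta (fun w => xi (s, w))).
Proof.
move=> b0 mxi; apply: (measurability _ (ErealGenInftyO.measurableE R)).
move=> _ /= [_ [a ->] <-]; rewrite setTI.
pose I (q : R) (s : S) := \int[P]_w (orlicz beta q (xi (s, w)) - 1).
have mI q : measurable_fun setT (I q).
  pose g (z : S * T) := orlicz beta q (xi z) - 1.
  have mg : measurable_fun setT g.
    apply: emeasurable_funB; last exact: measurable_cst.
    by apply: measurableT_comp => //; exact: measurable_orlicz.
  have g0 z : 0 <= g z by rewrite sube_ge0 ?orlicz_ge1.
  exact: (measurable_fun_fubini_tonelli_F (m2 := P) g mg g0).
suff E : (fun s => psi_norm P beta (fun w => xi (s, w))) @^-1` `]-oo, a%:E[ =
    \bigcup_(q in [set: rat]) [set s | (0 < (ratr q : R) < a)%R && (I (ratr q) s <= 1)].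
  rewrite E.
  apply: bigcupT_measurable_rat => q.
  have [qa|_] := boolP (0 < (ratr q : R) < a)%R; last by rewrite set_false.
  by rewrite -[X in measurable X]setTI; exact: emeasurable_fun_infty_c.
apply/seteqP; split => x /=; rewrite in_itv/=.
- move=> /ereal_inf_lt[_ [c [c0 H] <-]]; rewrite lte_fin => ca.
  have [q qca] := rat_in_itvoo ca; rewrite in_itv/= in qca.
  have /andP[cq qa] := qca.
  exists q => //=; rewrite (lt_trans c0)// qa /=.
  apply: (psi_norm_lt b0); first exact: measurableT_comp.
  apply: (@le_lt_trans _ _ c%:E); last by rewrite lte_fin.
  by apply: ereal_inf_lbound; exists c.
- move=> [q _ /= /andP[/andP[q0 qa] H]]; apply: (@le_lt_trans _ _ (ratr q)%:E).
    by apply: ereal_inf_lbound; exists (ratr q).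
  by rewrite lte_fin.
Qed.

(** The conditional half of the truncation argument: [xi] is the kernel with the
    first argument frozen.  If [m] or [b] is infinite, so is the right-hand
    side. *)
Lemma integral_expR_split beta u (xi : T -> R) (m b : \bar R) :
  (0 < beta <= 1)%R -> (0 < u)%R ->
  measurable_fun setT xi -> (forall w, 0 <= xi w)%R ->
  m = \int[P]_w (xi w)%:E -> b = psi_norm P beta (fun w => (xi w)%:E - m) ->
  \int[P]_w (expR (4^-1 * (xi w / u) `^ (beta / 2)))%:E <=
    (expR 1 / 4)%:E * (orlicz beta u m + 2 + 2 * orlicz beta u b).
Proof.
move=> b01 u0 mxi xi0 mE bE.
have b0 : (0 < beta)%R by case/andP: b01.
have e40 : (0 < expR 1 / 4 :> R)%R by rewrite divr_gt0 ?expR_gt0.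
have m0 : 0 <= m by rewrite mE; apply: integral_ge0 => w _; rewrite lee_fin.
have bb0 : 0 <= b by rewrite bE; exact: psi_norm_ge0.
have o0 x : 0 <= 2 * orlicz beta u x by rewrite mule_ge0 ?orlicz_ge0.
have [moo|moo] := eqVneq m +oo.
  rewrite moo orlicz_pinfty// addye ?addye ?gt0_muley ?leey//.
  by rewrite -ltNye (lt_le_trans (ltNyr 0)).
have [boo|boo] := eqVneq b +oo.
  rewrite boo orlicz_pinfty// gt0_muley// addey ?gt0_muley ?leey//.
  by rewrite -ltNye (lt_le_trans (ltNyr 0))// adde_ge0 ?orlicz_ge0.
have mfin : m \is a fin_num by rewrite ge0_fin_numE// ltey.
have bfin : b \is a fin_num by rewrite ge0_fin_numE// ltey.
pose D w := orlicz beta (fine b + u) ((xi w)%:E - m).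
have mxim : measurable_fun setT (fun w => (xi w)%:E - m).
  apply: emeasurable_funB; last exact: measurable_cst.
  exact/measurable_EFinP.
have mD : measurable_fun setT D.
  by apply: (measurableT_comp (measurable_orlicz _ _) mxim).
have D2 : \int[P]_w D w <= 2.
  apply: psi_norm_lt_orlicz => //; first exact: ltW.
  by rewrite -bE -{1}(fineK bfin) lte_fin ltrDl.
have fb0 : (0 <= fine b)%R by exact: fine_ge0.
have fm0 : (0 <= fine m)%R by exact: fine_ge0.
set A := orlicz beta u m; set E := orlicz beta u b.
have AE : A = (expR ((fine m / u) `^ beta))%:E.
  by rewrite /A -{1}(fineK mfin) orlicz_EFin ger0_norm.
have EE : E = (expR ((fine b / u) `^ beta))%:E.
  by rewrite /E -{1}(fineK bfin) orlicz_EFin ger0_norm.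
have A0 : 0 <= A + 2 * E by rewrite adde_ge0 ?orlicz_ge0 ?o0.
have EFin_sum (k x y z : R) : (k * (x + y + 2 * z))%:E =
    k%:E * (x%:E + 2 * z%:E + y%:E).
  by rewrite EFinM !EFinD EFinM addeAC.
have mAD : measurable_fun setT (fun w => A + 2 * E + D w).
  by apply: emeasurable_funD => //; exact: measurable_cst.
apply: (@le_trans _ _ (\int[P]_w ((expR 1 / 4)%:E * (A + 2 * E + D w)))).
  apply: ge0_le_integral => //.
  - apply/measurable_EFinP.
    exact: (measurableT_comp (measurable_expR_powR _ _ _) mxi).
  - exact: measurable_funeM.
  - move=> w _.
    have -> : D w = (expR ((`|xi w - fine m| / (fine b + u)) `^ beta))%:E.
      by rewrite /D -{1}(fineK mfin) -EFinB orlicz_EFin.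
    have xm : (xi w <= fine m + `|xi w - fine m|)%R.
      by have := ler_norm (xi w - fine m)%R; rewrite lerBlDl.
    have := expR_split b01 u0 fm0 (normr_ge0 (xi w - fine m)%R) fb0 (xi0 w) xm.
    by rewrite -lee_fin EFin_sum -AE -EE.
rewrite ge0_integralZl//; last by move=> w _; rewrite adde_ge0// orlicz_ge0.
rewrite lee_pmul2l// ge0_integralD//; last by move=> w _; exact: orlicz_ge0.
rewrite (integral_probability_cst (A + 2 * E)).
by rewrite addeAC leeD2r// leeD2l.
Qed.

End orlicz.

(** * Exponential moments of truncated averages *)

Section bounded_mgf.
Context d (T : measurableType d) (R : realType) (P : probability T R).

(** By [expR_half_le1D] the mean of [exp (Y / (2 B))] is at most [1 + m / B],
    hence at most [exp (m / B)]. *)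
Lemma bounded_mgf_le1 (Y : T -> R) (B m : R) : (0 < B)%R ->
  measurable_fun setT Y -> (forall w, 0 <= Y w <= B)%R ->
  \int[P]_w (Y w)%:E = m%:E ->
  \int[P]_w (expR ((Y w - 2 * m) / (2 * B)))%:E <= 1.
Proof.
move=> B0 mY Y01 Ym.
pose c := expR (- (m / B)).
have c0 : (0 <= c)%R by exact: expR_ge0.
have mYE : measurable_fun setT (EFin \o Y) by exact/measurable_EFinP.
apply: (@le_trans _ _ (\int[P]_w (c%:E * (1 + (B^-1)%:E * (Y w)%:E)))).
  apply: ge0_le_integral => //.
  - apply/measurable_EFinP.
    have m1 : measurable_fun setT (fun w => (Y w - 2 * m) / (2 * B))%R.
      apply: measurable_funM; last exact: measurable_cst.
      by apply: measurable_funB => //; exact: measurable_cst.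
    exact: (measurableT_comp (@measurable_expR R) m1).
  - apply: measurable_funeM; apply: emeasurable_funD; first exact: measurable_cst.
    exact: measurable_funeM.
  - move=> w _; rewrite -[leRHS]/((c * (1 + B^-1 * Y w))%:E) lee_fin.
    have -> : ((Y w - 2 * m) / (2 * B) = - (m / B) + (B^-1 * Y w) / 2)%R.
      by field; rewrite gt_eqF.
    rewrite expRD ler_wpM2l// expR_half_le1D//.
    have /andP[h1 h2] := Y01 w.
    by rewrite mulr_ge0 ?invr_ge0 ?(ltW B0)//= mulrC ler_pdivrMr ?mul1r.
have mc : measurable_fun setT (fun w => (B^-1)%:E * (Y w)%:E).
  exact: measurable_funeM.
have c1 w : 0 <= (B^-1)%:E * (Y w)%:E.
  by rewrite -EFinM lee_fin mulr_ge0 ?invr_ge0 ?(ltW B0)//; case/andP: (Y01 w).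
have Y0 w : 0 <= (Y w)%:E by rewrite lee_fin; case/andP: (Y01 w).
have c2 w : 0 <= 1 + (B^-1)%:E * (Y w)%:E by rewrite adde_ge0.
have m2 : measurable_fun setT (fun w => 1 + (B^-1)%:E * (Y w)%:E).
  by apply: emeasurable_funD.
have B'0 : 0 <= (B^-1)%:E by rewrite lee_fin invr_ge0 ltW.
rewrite ge0_integralZl// ge0_integralD//.
rewrite (integral_probability_cst P 1) ge0_integralZl//.
rewrite Ym -[leLHS]/((c * (1 + B^-1 * m))%:E) lee_fin.
apply: (@le_trans _ _ (c * expR (B^-1 * m))%R).
  by rewrite ler_wpM2l// expR_ge1Dx.
by rewrite /c mulrC [(B^-1 * m)%R]mulrC expRxMexpNx_1.
Qed.

End bounded_mgf.


Section blocks.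
Context (n r : nat).

Lemma block_lt (l : 'I_(n %/ r)) (i : 'I_r) : (l * r + i < n)%N.
Proof.
have := ltn_ord l; have := ltn_ord i; have := leq_divM n r; nia.
Qed.

(** The blocks are consecutive intervals of length [r]; the last [n %% r] indices
    belong to none. *)
Definition block (l : 'I_(n %/ r)) : r.-tuple 'I_n :=
  [tuple Ordinal (block_lt l i) | i < r].

Lemma block_inj l l' (i i' : 'I_r) :
  tnth (block l) i = tnth (block l') i' -> l = l' /\ i = i'.
Proof.
rewrite !tnth_mktuple => /(congr1 val)/= E.
have r0 : (0 < r)%N by case: (r) i {E i'} => [[]|].
have D (a b : nat) : (b < r)%N -> ((a * r + b) %/ r = a)%N.
  by move=> br; rewrite divnMDl// divn_small// addn0.
have : l = l' :> nat by rewrite -(D l i)// E D.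
move=> ll; split; apply: val_inj => //=.
by move: E; rewrite ll => /addnI.
Qed.

Lemma uniq_block l : uniq (block l).
Proof. by apply/tuple_uniqP => i i' /block_inj[]. Qed.

Lemma uniq_perm_block (s : {perm 'I_n}) l : uniq (perm_tuple s (block l)).
Proof. by rewrite map_inj_uniq ?uniq_block//; exact: perm_inj. Qed.

Lemma disjoint_perm_block (s : {perm 'I_n}) l l' : l != l' ->
  [disjoint [set i in perm_tuple s (block l)]%SET &
            [set i in perm_tuple s (block l')]%SET]%B.
Proof.
move=> ll; rewrite -finset.setI_eq0; apply/eqP/finset.setP => i.
rewrite !inE; apply/negbTE/negP => /andP[/tnthP[k ->] /tnthP[k']].
rewrite (tnth_map s (block l)) (tnth_map s (block l')) => /perm_inj/block_inj[].
by move/eqP; rewrite (negbTE ll).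
Qed.

End blocks.

Section symmetric_statistic.
Context dT (T : measurableType dT) (R : realType) (P : probability T R).
Context dS (S : measurableType dS) (n r : nat) (X : 'I_n -> {RV P >-> S}).

Lemma subfamily_perm_eq (E : Type) (phi : r.-tuple S -> E) (t u : r.-tuple 'I_n) w :
  (forall (s : {perm 'I_r}) x, phi [tuple tnth x (s k) | k < r] = phi x) ->
  perm_eq t u -> phi (subfamily X t w) = phi (subfamily X u w).
Proof.
move=> sphi /tuple_permP[s ts]; rewrite -(sphi s (subfamily X u w)).
congr phi; apply: eq_from_tnth => k; rewrite !tnth_mktuple.
by congr (X _ w); have := congr1 (fun z => nth (tnth t k) z k) ts;
  rewrite -!tnth_nth tnth_mktuple.
Qed.

Lemma card_inc_tuple_gt0 : (r <= n)%N -> (0 < #|{: inc_tuple n r}|)%N.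
Proof.
move=> rn; apply/card_gt0P.
suff st : sorted ltn [seq val i | i <- first_indices rn].
  by exists (Sub (first_indices rn) st : inc_tuple n r).
have -> : [seq val i | i <- first_indices rn] = iota 0 r.
  rewrite /first_indices/= -map_comp -val_enum_ord; exact: eq_map.
exact: iota_ltn_sorted.
Qed.

(** Hoeffding's representation.  The average over increasing tuples is an
    average over permutations [s] of the mean over the blocks permuted by [s];
    Jensen's inequality moves the exponential inside, where the blocks are
    independent and [bounded_mgf_le1] applies to each. *)
Lemma symmetric_average_mgf (phi : r.-tuple S -> R) (B m : R) (t0 : r.-tuple 'I_n) :
  iid X -> (r <= n)%N -> uniq t0 -> (0 < B)%R -> measurable_fun setT phi ->
  (forall x, 0 <= phi x <= B)%R ->
  (forall (s : {perm 'I_r}) x, phi [tuple tnth x (s k) | k < r] = phi x) ->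
  \int[P]_w (phi (subfamily X t0 w))%:E = m%:E ->
  \int[P]_w (expR ((n %/ r)%:R / (2 * B) *
    (#|{: inc_tuple n r}|%:R^-1 *
      \sum_(i : inc_tuple n r) phi (subfamily X (val i) w) - 2 * m)))%:E <= 1.
Proof.
move=> iX rn ut0 B0 mphi phi01 sphi phim.
pose Y (s : {perm 'I_n}) l w :=
  expR ((phi (subfamily X (perm_tuple s (block l)) w) - 2 * m) / (2 * B)).
pose N := #|{perm 'I_n}|.
have NE : N = n`! by rewrite /N -card_Sn.
have N0 : (0 < N)%N by rewrite NE fact_gt0.
have mexp : measurable_fun setT (fun x => expR ((phi x - 2 * m) / (2 * B))%R).
  have m1 : measurable_fun setT (fun x => (phi x - 2 * m) / (2 * B))%R.
    apply: measurable_funM; last exact: measurable_cst.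
    by apply: measurable_funB => //; exact: measurable_cst.
  exact: (measurableT_comp (@measurable_expR R) m1).
have mYl s l : determined_by X [set i in perm_tuple s (block l)]%SET (Y s l).
  apply: (determined_by_comp mexp).
  exact: (determined_by_subfamily (X := X) (t := perm_tuple s (block l))).
have mY s : measurable_fun setT (fun w => \prod_l Y s l w)%R.
  apply: measurable_prod => l _; exact: (determined_by_measurable (mYl s l)).
have Yprod s : \int[P]_w (\prod_l Y s l w)%:E <= 1.
  rewrite (integral_prod_groups (X := X)
      (J := fun l => [set i in perm_tuple s (block l)]%SET)).
  - suff /andP[] : 0 <= \prod_l \int[P]_w (Y s l w)%:E <= 1 by [].
    apply: (big_ind (fun x : \bar R => 0 <= x <= 1)) => [|x y|l _].
    + by rewrite lexx lee_fin ler01.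
    + move=> /andP[x0 x1] /andP[y0 y1]; rewrite mule_ge0//=.
      by rewrite -[leRHS]mule1 lee_pmul.
    rewrite integral_ge0/=; last by move=> w _; rewrite lee_fin expR_ge0.
    apply: bounded_mgf_le1 => //.
      exact/measurableT_comp/measurable_subfamily.
    rewrite -phim; apply: (integral_subfamily (psi := fun x => (phi x)%:E)) => //.
    + exact: uniq_perm_block.
    + exact/measurable_EFinP.
    + by move=> x; rewrite lee_fin; case/andP: (phi01 x).
  - by case: iX.
  - exact: index_enum_uniq.
  - by move=> l l' _ _; exact: disjoint_perm_block.
  - exact: mYl.
  - by move=> l w; exact: expR_ge0.
have mphiX (t : r.-tuple 'I_n) : measurable_fun setT (fun w => phi (subfamily X t w)).
  exact/measurableT_comp/measurable_subfamily.
have NR0 : (0 < N%:R :> R)%R by rewrite ltr0n.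
have IR0 : (0 < #|{: inc_tuple n r}|%:R :> R)%R by rewrite ltr0n card_inc_tuple_gt0.
have YE w s : (\prod_l Y s l w = expR (\sum_l
    ((phi (subfamily X (perm_tuple s (block l)) w) - 2 * m) / (2 * B))))%R.
  by rewrite expR_sum.
have sumE w : ((n %/ r)%:R / (2 * B) * (#|{: inc_tuple n r}|%:R^-1 *
      \sum_(i : inc_tuple n r) phi (subfamily X (val i) w) - 2 * m) =
    N%:R^-1 * \sum_(s : {perm 'I_n}) \sum_(l < n %/ r)
      ((phi (subfamily X (perm_tuple s (block l)) w) - 2 * m) / (2 * B)))%R.
  rewrite exchange_big/=.
  set avg := (#|_|%:R^-1 * _)%R.
  have sE (l : 'I_(n %/ r)) :
      (\sum_(s : {perm 'I_n}) phi (subfamily X (perm_tuple s (block l)) w) = N%:R * avg)%R.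
    have := average_inc_tuple (phi := fun t => phi (subfamily X t w))
      (fun u v uv => subfamily_perm_eq w sphi uv) (uniq_block l).
    rewrite -NE /avg => H; rewrite mulrCA -H mulrA mulVf ?mul1r// gt_eqF//.
  have sE2 (l : 'I_(n %/ r)) : (\sum_(s : {perm 'I_n})
      ((phi (subfamily X (perm_tuple s (block l)) w) - 2 * m) / (2 * B)) =
      N%:R * ((avg - 2 * m) / (2 * B)))%R.
    rewrite -mulr_suml sumrB sE sumr_const -[((2 * m) *+ _)%R]mulr_natl -/N.
    by rewrite -mulrBr mulrA.
  under eq_bigr do rewrite sE2.
  rewrite sumr_const card_ord -[(_ *+ (n %/ r))%R]mulr_natl.
  by field; rewrite !gt_eqF.
have mP s : measurable_fun setT (fun w => (\prod_l Y s l w)%:E).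
  exact/measurable_EFinP.
apply: (@le_trans _ _ (\int[P]_w ((N%:R^-1)%:E * \sum_s (\prod_l Y s l w)%:E))).
  apply: ge0_le_integral => //.
  - apply/measurable_EFinP.
    have m1 : measurable_fun setT (fun w => (n %/ r)%:R / (2 * B) *
        (#|{: inc_tuple n r}|%:R^-1 *
        \sum_(i : inc_tuple n r) phi (subfamily X (val i) w) - 2 * m))%R.
      apply: measurable_funM; first exact: measurable_cst.
      apply: measurable_funB; last exact: measurable_cst.
      apply: measurable_funM; first exact: measurable_cst.
      exact: measurable_sum.
    exact: (measurableT_comp (@measurable_expR R) m1).
  - by apply: measurable_funeM; exact: emeasurable_sum.
  - move=> w _; rewrite sumEFin -EFinM lee_fin sumE.
    under [in leRHS]eq_bigr do rewrite YE.
    exact: expR_average.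
have P0 s w : 0 <= (\prod_l Y s l w)%:E.
  by rewrite lee_fin prodr_ge0// => l _; exact: expR_ge0.
have S0 w : 0 <= \sum_s (\prod_l Y s l w)%:E by apply: sume_ge0.
have mS : measurable_fun setT (fun w => \sum_s (\prod_l Y s l w)%:E).
  by apply: emeasurable_sum.
have N'0 : 0 <= (N%:R^-1 : R)%:E by rewrite lee_fin invr_ge0 ltW.
rewrite ge0_integralZl// ge0_integral_sum//.
apply: (@le_trans _ _ ((N%:R^-1)%:E * \sum_(s : {perm 'I_n}) 1)).
  by rewrite lee_wpmul2l// lee_sum.
rewrite sumEFin -EFinM lee_fin sumr_const -/N mulVf// gt_eqF//.
Qed.

End symmetric_statistic.

Section two_families.
Context dT (T : measurableType dT) (R : realType) (P : probability T R).
Context dS (S : measurableType dS) (n r : nat) (X : 'I_n -> {RV P >-> S}).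
Context dS' (S' : measurableType dS') (J : finType) (V : J -> {RV P >-> S'}).
Hypotheses (iX : iid X) (iV : iid V) (XV : independent_families X V).

(** Replaces the pair formed by a tuple of the [X_i] and the variable [V i] by
    reference variables that are integrated separately. *)
Lemma integral_transfer (t u : r.-tuple 'I_n) (i j : J)
    (psi : r.-tuple S * S' -> \bar R) : uniq t -> uniq u ->
  measurable_fun setT psi -> (forall z, 0 <= psi z) ->
  \int[P]_w psi (subfamily X t w, V i w) =
  \int[P]_w \int[P]_w' psi (subfamily X u w, V j w').
Proof.
move=> ut uu mpsi psi0.
transitivity (\int[P]_w \int[P]_w' psi (subfamily X t w, V i w')).
  exact: (integral_independent_families t i (psi := psi) XV).
transitivity (\int[P]_w \int[P]_w' psi (subfamily X t w, V j w')).
  apply: eq_integral => w _.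
  apply: (integral_identically_distributed (V := V) i j
    (psi := fun y => psi (subfamily X t w, y))) => //; first by case: iV.
  by apply: (measurableT_comp mpsi); exact: measurable_fun_pair.
apply: (integral_subfamily (psi := fun x => \int[P]_w' psi (x, V j w'))) => //.
  exact: measurable_kernel_integral.
by move=> x; apply: integral_ge0.
Qed.

(** Conditioning on [X] is integration over an independent copy: the two
    families are seen as the identity maps towards their sigma-algebras, and once
    [X] is frozen the [V (sg l)] are independent with conditional means
    [g (X_(tau l))]. *)
Lemma conditional_mgf_le1 (L : finType) (tau : L -> r.-tuple 'I_n) (sg : L -> J)
    (h : r.-tuple S * S' -> R) (g : r.-tuple S -> R) (B : R) :
  injective sg -> (0 < B)%R -> measurable_fun setT h -> measurable_fun setT g ->
  (forall z, 0 <= h z <= B)%R ->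
  (forall x j, \int[P]_w (h (x, V j w))%:E = (g x)%:E) ->
  \int[P]_w (expR (\sum_l (h (subfamily X (tau l) w, V (sg l) w)
     - 2 * g (subfamily X (tau l) w)) / (2 * B)))%:E <= 1.
Proof.
move=> isg B0 mh mg h01 gE.
pose GX := \bigcup_i preimage_set_system setT (X i) measurable.
pose GV := \bigcup_j preimage_set_system setT (V j) measurable.
pose T1 : measurableType _ := g_sigma_algebraType GX.
pose T2 : measurableType _ := g_sigma_algebraType GV.
have mi1 : measurable_fun [set: T] (id : T -> T1).
  move=> _ A mA; rewrite setTI; move: A mA.
  apply: smallest_sub; first exact: sigma_algebra_measurable.
  by move=> _ [i _ [A mA <-]]; rewrite setTI; exact: measurable_funPTI.
have mi2 : measurable_fun [set: T] (id : T -> T2).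
  move=> _ A mA; rewrite setTI; move: A mA.
  apply: smallest_sub; first exact: sigma_algebra_measurable.
  by move=> _ [i _ [A mA <-]]; rewrite setTI; exact: measurable_funPTI.
pose Y (l : L) (z : T1 * T2) : R :=
  expR ((h (subfamily X (tau l) z.1, V (sg l) z.2)
     - 2 * g (subfamily X (tau l) z.1)) / (2 * B)).
have mXt l : measurable_fun [set: T1] (subfamily X (tau l)).
  by move=> _ A mA; rewrite setTI; exact: sigma_family_subfamily.
have mVs l : measurable_fun [set: T2] (V (sg l)).
  move=> _ A mA; rewrite setTI; apply: sub_sigma_algebra.
  by exists (sg l) => //; exists A => //; rewrite setTI.
have mY l : measurable_fun [set: (T1 * T2)%type] (Y l).
  have m1 : measurable_fun [set: (T1 * T2)%type] (fun z => subfamily X (tau l) z.1).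
    exact: (measurableT_comp (mXt l)).
  have m2 : measurable_fun [set: (T1 * T2)%type] (fun z => V (sg l) z.2).
    exact: (measurableT_comp (mVs l)).
  have m3 := measurableT_comp mh (measurable_fun_pair m1 m2).
  have m4 := measurableT_comp mg m1.
  have m5 : measurable_fun [set: (T1 * T2)%type]
      (fun z => (h (subfamily X (tau l) z.1, V (sg l) z.2)
         - 2 * g (subfamily X (tau l) z.1)) / (2 * B))%R.
    apply: measurable_funM; last exact: measurable_cst.
    by apply: measurable_funB => //; apply: measurable_funM => //; exact: measurable_cst.
  exact: (measurableT_comp (@measurable_expR R) m5).
pose phi (z : T1 * T2) := (\prod_l Y l z)%:E.
have mphi : measurable_fun setT phi.
  by apply/measurable_EFinP; exact: measurable_prod.
have phi0 z : 0 <= phi z.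
  by rewrite lee_fin prodr_ge0// => l _; exact: expR_ge0.
rewrite (eq_integral (fun w : T => phi ((w : T1), (w : T2)))); last first.
  by move=> w _; rewrite /phi/= -expR_sum.
rewrite (integral_independent_pair (Y1 := id : T -> T1) (Y2 := id : T -> T2)
  mi1 mi2 XV mphi phi0).
have mh1 (x : r.-tuple S) : measurable_fun setT (fun y => h (x, y)).
  by apply: (measurableT_comp mh); exact: measurable_fun_pair.
rewrite -[leRHS](integral_probability_cst P 1).
apply: ge0_le_integral => //.
- by move=> w _; apply: integral_ge0.
- pose f (z : T * T) := phi (z.1, z.2).
  have mf : measurable_fun setT f.
    apply: (measurableT_comp mphi); apply: measurable_fun_pair.
      exact: (measurableT_comp mi1 (@measurable_fst _ _ T T)).
    exact: (measurableT_comp mi2 (@measurable_snd _ _ T T)).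
  exact: (measurable_fun_fubini_tonelli_F (m2 := P) f mf (fun z => phi0 _)).
move=> w _; rewrite /phi (integral_prod_groups (X := V)
    (J := fun l => [set sg l]%SET) (Y := fun l w' => Y l (w, w'))).
- suff /andP[] : 0 <= \prod_l \int[P]_w' (Y l (w, w'))%:E <= 1 by [].
  apply: (big_ind (fun x : \bar R => 0 <= x <= 1)) => [|x y|l _].
  + by rewrite lexx lee_fin ler01.
  + move=> /andP[x0 x1] /andP[y0 y1]; rewrite mule_ge0//=.
    by rewrite -[leRHS]mule1 lee_pmul.
  rewrite integral_ge0/=; last by move=> w' _; rewrite lee_fin expR_ge0.
  have mhl : measurable_fun setT (fun w' => h (subfamily X (tau l) w, V (sg l) w')).
    exact: (measurableT_comp (mh1 _)).
  exact: (bounded_mgf_le1 (P := P) B0 mhl (fun w' => h01 _) (gE _ _)).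
- by case: iV.
- exact: index_enum_uniq.
- move=> l l' _ _ ll; rewrite finset.disjoints1 finset.in_set1.
  by apply: contra ll => /eqP/isg ->.
- move=> l.
  have m1 : measurable_fun setT (fun y => expR ((h (subfamily X (tau l) w, y)
     - 2 * g (subfamily X (tau l) w)) / (2 * B)))%R.
    have m2 : measurable_fun setT (fun y => (h (subfamily X (tau l) w, y)
     - 2 * g (subfamily X (tau l) w)) / (2 * B))%R.
      apply: measurable_funM; last exact: measurable_cst.
      by apply: measurable_funB => //; exact: measurable_cst.
    exact: (measurableT_comp (@measurable_expR R) m2).
  apply: (determined_by_comp m1).
  by apply: determined_by_var; rewrite finset.set11.
- by move=> l w'; exact: expR_ge0.
Qed.

End two_families.

(** * Means of excesses *)

Section excess.
Context dT (T : measurableType dT) (R : realType) (P : probability T R).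

(** Solution [B] of [c / 2 (B / u)^g = 2 L]: with an exponential moment of
    [c (Y / u)^g], the mean excess above [B] is of order [exp (- 2 L)]. *)
Definition level (c g u L : R) : R := (u * (4 * L / c) `^ g^-1)%R.

Lemma level_gt0 (c g u L : R) : (0 < c -> 0 < u -> 0 < L -> 0 < level c g u L)%R.
Proof.
by move=> c0 u0 L0; rewrite mulr_gt0 ?powR_gt0 ?divr_gt0 ?mulr_gt0.
Qed.

Definition excess_constant (c g M : R) : R := ((c / 2 * g) `^ (- g^-1) * M)%R.

Lemma excess_constant_gt0 (c g M : R) :
  (0 < c -> 0 < g -> 0 < M -> 0 < excess_constant c g M)%R.
Proof. by move=> c0 g0 M0; rewrite mulr_gt0// powR_gt0// mulr_gt0// divr_gt0. Qed.

(** The factor [exp (- 2 L)] leaves [exp (- L)] after Markov's inequality at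
    level [exp L]. *)
Lemma integral_excess_le (c g u L M : R) (Y : T -> R) :
  (0 < c)%R -> (0 < g)%R -> (0 < u)%R -> (0 < L)%R ->
  measurable_fun setT Y -> (forall w, 0 <= Y w)%R ->
  \int[P]_w (expR (c * (Y w / u) `^ g))%:E <= M%:E ->
  \int[P]_w (Num.max (Y w - level c g u L) 0)%:E <=
    (excess_constant c g M * u * expR (- (2 * L)))%:E.
Proof.
move=> c0 g0 u0 L0 mY Y0 YM.
set B := level c g u L.
have B0 : (0 <= B)%R by rewrite ltW// level_gt0.
have BL : (c / 2 * (B / u) `^ g = 2 * L)%R.
  have -> : (B / u = (4 * L / c) `^ g^-1)%R.
    by rewrite /B /level mulrAC divff ?mul1r// gt_eqF.
  rewrite -powRrM mulVf ?gt_eqF// powRr1; last by rewrite divr_ge0 ?mulr_ge0 ?ltW.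
  by field; rewrite gt_eqF.
pose a : R := ((c / 2 * g) `^ (- g^-1) * u * expR (- (2 * L)))%R.
have a0 : (0 <= a)%R by rewrite !mulr_ge0 ?powR_ge0 ?expR_ge0 ?ltW.
have mE : measurable_fun setT (fun w => (expR (c * (Y w / u) `^ g))%:E).
  by apply/measurable_EFinP; exact: (measurableT_comp (measurable_expR_powR _ _ _) mY).
have E0 w : 0 <= (expR (c * (Y w / u) `^ g))%:E by rewrite lee_fin expR_ge0.
apply: (@le_trans _ _ (\int[P]_w (a%:E * (expR (c * (Y w / u) `^ g))%:E))).
  apply: ge0_le_integral => //.
  - by move=> w _; rewrite lee_fin le_max lexx orbT.
  - apply/measurable_EFinP; apply: measurable_maxr; last exact: measurable_cst.
    by apply: measurable_funB => //; exact: measurable_cst.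
  - exact: measurable_funeM.
  - by move=> w _; rewrite -EFinM lee_fin /a -BL; exact: excess_le_expR.
rewrite ge0_integralZl//.
apply: (@le_trans _ _ (a%:E * M%:E)); first by rewrite lee_wpmul2l.
by rewrite -EFinM lee_fin /a /excess_constant le_eqVlt; apply/orP; left; apply/eqP; ring.
Qed.

Lemma integral_average_le (I : finType) (Z : I -> T -> R) (c : R) :
  (0 < #|I|)%N -> (forall i, measurable_fun setT (Z i)) ->
  (forall i w, 0 <= Z i w)%R -> (forall i, \int[P]_w (Z i w)%:E <= c%:E) ->
  \int[P]_w (#|I|%:R^-1 * \sum_i Z i w)%:E <= c%:E.
Proof.
move=> I0 mZ Z0 Zc.
have IR0 : (0 < #|I|%:R :> R)%R by rewrite ltr0n.
have I'0 : 0 <= (#|I|%:R^-1 : R)%:E by rewrite lee_fin invr_ge0 ltW.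
have Z0' i w : 0 <= (Z i w)%:E by rewrite lee_fin.
have mZ' i : measurable_fun setT (fun w => (Z i w)%:E) by exact/measurable_EFinP.
under eq_integral do rewrite EFinM -sumEFin.
have mS : measurable_fun setT (fun w => \sum_i (Z i w)%:E) by apply: emeasurable_sum.
have S0 w : 0 <= \sum_i (Z i w)%:E by apply: sume_ge0.
rewrite ge0_integralZl// ge0_integral_sum//.
apply: (@le_trans _ _ ((#|I|%:R^-1)%:E * \sum_(i : I) c%:E)).
  by rewrite lee_wpmul2l// lee_sum.
rewrite sumEFin -EFinM lee_fin sumr_const -[(c *+ _)%R]mulr_natl mulrA.
by rewrite mulVf ?mul1r// gt_eqF.
Qed.

End excess.

(** * The bound for one coordinate *)

Lemma min_add_excess (R : realType) (x B : R) :
  (Num.min x B + Num.max (x - B) 0 = x)%R.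
Proof.
have [xB|Bx] := leP x B; first by rewrite max_r ?subr_le0// addr0.
by rewrite max_l ?subr_ge0 ?ltW// addrC subrK.
Qed.

(** Adding up integrals in which [b_j] occurs requires its measurability. *)
Lemma measurable_conditional_psi_norm dT (T : measurableType dT) (R : realType)
    (P : probability T R) dS (S : measurableType dS) dS' (S' : measurableType dS')
    (V : {RV P >-> S'}) (K : S * S' -> R) (beta : R) : (0 <= beta)%R ->
  measurable_fun setT K -> (forall z, 0 <= K z)%R ->
  measurable_fun setT (fun x => psi_norm P beta
    (fun w => (K (x, V w))%:E - \int[P]_w' (K (x, V w'))%:E)).
Proof.
move=> beta0 mK K0.
apply: (@measurable_psi_norm R _ T P beta _ _ (fun z : S * T =>
  (K (z.1, V z.2))%:E - \int[P]_w' (K (z.1, V w'))%:E)) => //.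
apply: emeasurable_funB.
  apply/measurable_EFinP; apply: (measurableT_comp mK).
  by apply: measurable_fun_pair => //; exact: measurableT_comp.
have mf : measurable_fun setT (fun x => \int[P]_w' (K (x, V w'))%:E).
  apply: (measurable_kernel_integral (psi := fun z => (K z)%:E)).
    exact/measurable_EFinP.
  by move=> z; rewrite lee_fin.
exact: (measurableT_comp mf).
Qed.

Section one_coordinate.
Context dT (T : measurableType dT) (R : realType) (P : probability T R).
Context dS (S : measurableType dS) (n r : nat) (X : 'I_n -> {RV P >-> S}).
Context dS' (S' : measurableType dS') (J : finType) (V : J -> {RV P >-> S'}).
Hypotheses (iX : iid X) (iV : iid V) (XV : independent_families X V).
Variables (sg : inc_tuple n r -> J) (j0 : J) (t0 : r.-tuple 'I_n).
Hypotheses (isg : injective sg) (ut0 : uniq t0).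
Hypotheses (r_gt0 : (0 < r)%N) (rn : (r <= n)%N).
Variables (K : r.-tuple S * S' -> R) (beta u L : R).
Hypotheses (mK : measurable_fun setT K) (K0 : forall z, (0 <= K z)%R).
Hypothesis sK : symmetric_kernel K.
Hypotheses (beta01 : (0 < beta <= 1)%R) (u_gt0 : (0 < u)%R) (L_gt0 : (0 < L)%R).

Let f x := \int[P]_w (K (x, V j0 w))%:E.
Let b x := psi_norm P beta (fun w => (K (x, V j0 w))%:E - f x).

Hypothesis f_orlicz : \int[P]_w orlicz beta u (f (subfamily X t0 w)) <= 2.
Hypothesis b_orlicz : \int[P]_w orlicz beta u (b (subfamily X t0 w)) <= 2.

Let B1 := level 1 beta u L.
Let B0 := level 4^-1 (beta / 2) u L.
Let C1 := excess_constant 1 beta 2.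
Let C0 := excess_constant 4^-1 (beta / 2) (2 * expR 1).

Let beta_gt0 : (0 < beta)%R. Proof. by case/andP: beta01. Qed.
Let beta2_gt0 : (0 < beta / 2)%R. Proof. by rewrite divr_gt0. Qed.
Let B1_gt0 : (0 < B1)%R. Proof. exact: level_gt0. Qed.
Let B0_gt0 : (0 < B0)%R.
Proof. by apply: level_gt0; rewrite ?invr_gt0. Qed.
Let C1_gt0 : (0 < C1)%R. Proof. exact: excess_constant_gt0. Qed.
Let C0_gt0 : (0 < C0)%R.
Proof. by apply: excess_constant_gt0; rewrite ?invr_gt0 ?mulr_gt0 ?expR_gt0. Qed.

Let mKE : measurable_fun setT (fun z => (K z)%:E).
Proof. exact/measurable_EFinP. Qed.
Let f_ge0 x : 0 <= f x.
Proof. by apply: integral_ge0 => w _; rewrite lee_fin. Qed.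
Let mf : measurable_fun setT f.
Proof.
by apply: (measurable_kernel_integral (psi := fun z => (K z)%:E)) => // z; rewrite lee_fin.
Qed.

Let mKV x : measurable_fun setT (fun w => K (x, V j0 w)).
Proof.
have m1 : measurable_fun setT (fun w => (x, V j0 w)) by exact: measurable_fun_pair.
exact: (measurableT_comp mK m1).
Qed.

Let mb : measurable_fun setT b.
Proof. by apply: measurable_conditional_psi_norm => //; exact: ltW. Qed.

(** The kernel is cut at [B0], then the conditional mean of the cut kernel is cut
    at [B1]. *)
Let h z := Num.min (K z) B0.
Let h_bound z : (0 <= h z <= B0)%R.
Proof. by rewrite le_min K0 (ltW B0_gt0) ge_min lexx orbT. Qed.
Let mh : measurable_fun setT h.
Proof. by apply: measurable_minr => //; exact: measurable_cst. Qed.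
Let mhV x j : measurable_fun setT (fun w => h (x, V j w)).
Proof.
have m1 : measurable_fun setT (fun w => (x, V j w)) by exact: measurable_fun_pair.
exact: (measurableT_comp mh m1).
Qed.
Let h0E z : 0 <= (h z)%:E.
Proof. by rewrite lee_fin; case/andP: (h_bound z). Qed.
Let mhE : measurable_fun setT (fun z => (h z)%:E).
Proof. exact/measurable_EFinP. Qed.

Let g x := fine (\int[P]_w (h (x, V j0 w))%:E).

Let int_h_le x : \int[P]_w (h (x, V j0 w))%:E <= B0%:E.
Proof.
rewrite -[leRHS](integral_probability_cst P); apply: ge0_le_integral => //.
- exact/measurable_EFinP.
- by move=> w _; rewrite lee_fin; case/andP: (h_bound (x, V j0 w)).
Qed.

Let gE x : (g x)%:E = \int[P]_w (h (x, V j0 w))%:E.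
Proof.
rewrite fineK// ge0_fin_numE ?(le_lt_trans (int_h_le x)) ?ltry//.
exact: integral_ge0.
Qed.

Let gjE x j : \int[P]_w (h (x, V j w))%:E = (g x)%:E.
Proof.
rewrite gE; apply: (integral_identically_distributed (V := V) j j0
  (psi := fun y => (h (x, y))%:E)) => //; first by case: iV.
have m1 : measurable_fun setT (fun y : S' => (x, y)) by exact: measurable_fun_pair.
exact: (measurableT_comp mhE m1).
Qed.

Let g_ge0 x : (0 <= g x)%R.
Proof. by rewrite fine_ge0// integral_ge0. Qed.

Let mg : measurable_fun setT g.
Proof.
have m1 : measurable_fun setT (fun x => \int[P]_w (h (x, V j0 w))%:E).
  exact: (measurable_kernel_integral (psi := fun z => (h z)%:E)).
exact: (measurableT_comp (@fine_measurable R setT measurableT) m1).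
Qed.

Let g_le_f x : (g x)%:E <= f x.
Proof.
rewrite gE; apply: ge0_le_integral => //.
- exact/measurable_EFinP.
- exact/measurable_EFinP.
- by move=> w _; rewrite lee_fin ge_min lexx.
Qed.

Let phi x := Num.min (g x) B1.
Let phi_bound x : (0 <= phi x <= B1)%R.
Proof. by rewrite le_min g_ge0 (ltW B1_gt0) ge_min lexx orbT. Qed.
Let mphi : measurable_fun setT phi.
Proof. by apply: measurable_minr => //; exact: measurable_cst. Qed.

Let sphi (s : {perm 'I_r}) x : phi [tuple tnth x (s k) | k < r] = phi x.
Proof.
rewrite /phi; congr Num.min; congr fine; apply: eq_integral => w _.
by rewrite /h sK.
Qed.

Let m := fine (\int[P]_w (phi (subfamily X t0 w))%:E).

Let mXt (t : r.-tuple 'I_n) (F : r.-tuple S -> R) : measurable_fun setT F ->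
  measurable_fun setT (fun w => F (subfamily X t w)).
Proof. by move=> mF; apply: (measurableT_comp mF); exact: measurable_subfamily. Qed.

Let mE : \int[P]_w (phi (subfamily X t0 w))%:E = m%:E.
Proof.
rewrite fineK// ge0_fin_numE; last first.
  by apply: integral_ge0 => w _; rewrite lee_fin; case/andP: (phi_bound (subfamily X t0 w)).
apply: (@le_lt_trans _ _ (\int[P]_w B1%:E)); last first.
  by rewrite (integral_probability_cst P) ltry.
apply: ge0_le_integral => //.
- by move=> w _; rewrite lee_fin; case/andP: (phi_bound (subfamily X t0 w)).
- exact/measurable_EFinP/mXt.
- by move=> w _; rewrite lee_fin; case/andP: (phi_bound (subfamily X t0 w)).
Qed.

Let m_le : m%:E <= \int[P]_w f (subfamily X t0 w).
Proof.
rewrite -mE; apply: ge0_le_integral => //.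
- by move=> w _; rewrite lee_fin; case/andP: (phi_bound (subfamily X t0 w)).
- exact/measurable_EFinP/mXt.
- by apply: (measurableT_comp mf); exact: measurable_subfamily.
- by move=> w _; apply: le_trans (g_le_f _); rewrite lee_fin ge_min lexx.
Qed.

Let I := inc_tuple n r.
Let I_gt0 : (0 < #|{: I}|)%N. Proof. exact: card_inc_tuple_gt0. Qed.
Let XI (i : I) w := subfamily X (val i) w.
Let VI (i : I) w := V (sg i) w.

(** [g] inherits its exponential moment from the bound on [f]. *)
Let mean_excess1 (i : I) :
  \int[P]_w (Num.max (g (XI i w) - B1) 0)%:E <= (C1 * u * expR (- (2 * L)))%:E.
Proof.
apply: (integral_excess_le (Y := fun w => g (XI i w))) => //.
  exact: mXt.
have -> : \int[P]_w (expR (1 * (g (XI i w) / u) `^ beta))%:E =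
    \int[P]_w (expR (1 * (g (subfamily X t0 w) / u) `^ beta))%:E.
  apply: (integral_subfamily (psi := fun x => (expR (1 * (g x / u) `^ beta))%:E)) => //.
    exact: inc_tuple_uniq.
  by apply/measurable_EFinP; exact: (measurableT_comp (measurable_expR_powR _ _ _) mg).
apply: le_trans f_orlicz; apply: ge0_le_integral => //.
- apply/measurable_EFinP.
  exact: (measurableT_comp (measurable_expR_powR _ _ _) (mXt t0 mg)).
- apply: (measurableT_comp (measurable_orlicz _ _)).
  by apply: (measurableT_comp mf); exact: measurable_subfamily.
- move=> w _; set x := subfamily X t0 w.
  apply: (@le_trans _ _ (orlicz beta u (g x)%:E)).
    by rewrite orlicz_EFin mul1r ger0_norm.
  apply: le_orlicz => //; first exact: ltW.
  rewrite (gee0_abs (f_ge0 x)) gee0_abs; first exact: g_le_f.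
  by rewrite lee_fin.
Qed.

(** The exponential moment of the uncut kernel: [integral_expR_split] given [X],
    then the bounds on [f] and [b]; the sum of the constants is
    [e (2 + 2 + 4) / 4 = 2 e]. *)
Let mean_excess0 (i : I) :
  \int[P]_w (Num.max (K (XI i w, VI i w) - B0) 0)%:E <=
    (C0 * u * expR (- (2 * L)))%:E.
Proof.
apply: (integral_excess_le (Y := fun w => K (XI i w, VI i w))) => //.
  apply: (measurableT_comp mK); apply: measurable_fun_pair => //.
  exact: measurable_subfamily.
pose psi z := (expR (4^-1 * (K z / u) `^ (beta / 2)))%:E.
have mpsi : measurable_fun setT psi.
  by apply/measurable_EFinP; exact: (measurableT_comp (measurable_expR_powR _ _ _) mK).
have psi0 z : 0 <= psi z by rewrite lee_fin expR_ge0.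
rewrite (integral_transfer iX iV XV (sg i) j0 (inc_tuple_uniq i) ut0 mpsi psi0).
have mo (F : r.-tuple S -> \bar R) : measurable_fun setT F ->
    measurable_fun setT (fun w => orlicz beta u (F (subfamily X t0 w))).
  move=> mF; apply: (measurableT_comp (measurable_orlicz _ _)).
  by apply: (measurableT_comp mF); exact: measurable_subfamily.
have mof := mo f mf; have mob := mo b mb.
have o0 (x : \bar R) : 0 <= orlicz beta u x by exact: orlicz_ge0.
have mob2 : measurable_fun setT (fun w => 2 * orlicz beta u (b (subfamily X t0 w))).
  exact: measurable_funeM.
have mof2 : measurable_fun setT (fun w => orlicz beta u (f (subfamily X t0 w)) + 2).
  by apply: emeasurable_funD => //; exact: measurable_cst.
have ob2 (x : \bar R) : 0 <= 2 * orlicz beta u x by rewrite mule_ge0.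
have of2 (x : \bar R) : 0 <= orlicz beta u x + 2 by rewrite adde_ge0.
have ms : measurable_fun setT (fun w => orlicz beta u (f (subfamily X t0 w)) + 2
    + 2 * orlicz beta u (b (subfamily X t0 w))).
  exact: emeasurable_funD.
have os (x y : \bar R) : 0 <= orlicz beta u x + 2 + 2 * orlicz beta u y.
  by rewrite adde_ge0.
have e0 : 0 <= (expR 1 / 4 : R)%:E by rewrite lee_fin divr_ge0 ?expR_ge0.
apply: (@le_trans _ _ (\int[P]_w ((expR 1 / 4)%:E *
    (orlicz beta u (f (subfamily X t0 w)) + 2
      + 2 * orlicz beta u (b (subfamily X t0 w)))))).
  apply: ge0_le_integral => //.
  - by move=> w _; apply: integral_ge0.
  - apply: (@measurableT_comp _ _ _ _ _ _ (fun x => \int[P]_w' psi (x, V j0 w'))).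
      exact: measurable_kernel_integral.
    exact: measurable_subfamily.
  - exact: measurable_funeM.
  - by move=> w _; exact: integral_expR_split.
rewrite ge0_integralZl// ge0_integralD// ge0_integralD// ge0_integralZl//.
rewrite (integral_probability_cst P 2).
apply: (@le_trans _ _ ((expR 1 / 4)%:E * (2 + 2 + 2 * 2))).
  by rewrite lee_wpmul2l// leeD// ?leeD// lee_wpmul2l.
rewrite -[leLHS]/((expR 1 / 4 * (2 + 2 + 2 * 2))%:E) lee_fin.
by rewrite le_eqVlt; apply/orP; left; apply/eqP; field.
Qed.

Let avg (Z : I -> R) : R := (#|{: I}|%:R^-1 * \sum_i Z i)%R.

Let avgD (Z Z' : I -> R) : (avg (fun i => Z i + Z' i) = avg Z + avg Z')%R.
Proof. by rewrite /avg big_split mulrDr. Qed.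

Let le_avg (Z Z' : I -> R) : (forall i, Z i <= Z' i)%R -> (avg Z <= avg Z')%R.
Proof. by move=> ZZ; rewrite ler_wpM2l ?invr_ge0// ler_sum. Qed.

Let avg_ge0 (Z : I -> R) : (forall i, 0 <= Z i)%R -> (0 <= avg Z)%R.
Proof. by move=> Z0; rewrite mulr_ge0 ?invr_ge0 ?ler0n// sumr_ge0. Qed.

Let measurable_avg (Z : I -> T -> R) : (forall i, measurable_fun setT (Z i)) ->
  measurable_fun setT (fun w => avg (fun i => Z i w)).
Proof.
move=> mZ; apply: measurable_funM; first exact: measurable_cst.
exact: measurable_sum.
Qed.

(** An average of excesses, divided by the bound on its mean. *)
Let normalized_excess (Z : I -> T -> R) (B C : R) : (0 < C)%R ->
  (forall i, measurable_fun setT (Z i)) ->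
  (forall i, \int[P]_w (Num.max (Z i w - B) 0)%:E <= (C * u * expR (- (2 * L)))%:E) ->
  exists Q : T -> R, [/\ measurable_fun setT Q, (forall w, 0 <= Q w)%R,
    \int[P]_w (Q w)%:E <= 1 &
    forall w, (Q w <= expR L ->
      avg (fun i => Num.max (Z i w - B) 0) <= C * u * expR (- L))%R].
Proof.
move=> C0' mZ HZ; pose a : R := (C * u * expR (- (2 * L)))%R.
have a0 : (0 < a)%R by rewrite !mulr_gt0 ?expR_gt0.
have mZB i : measurable_fun setT (fun w => Num.max (Z i w - B) 0)%R.
  apply: measurable_maxr; last exact: measurable_cst.
  by apply: measurable_funB => //; exact: measurable_cst.
have Z0 i w : (0 <= Num.max (Z i w - B) 0)%R by rewrite le_max lexx orbT.
have mA := measurable_avg mZB.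
have A0 w : (0 <= avg (fun i => Num.max (Z i w - B) 0))%R by exact: avg_ge0.
exists (fun w => a^-1 * avg (fun i => Num.max (Z i w - B) 0))%R; split.
- by apply: measurable_funM => //; exact: measurable_cst.
- by move=> w; rewrite mulr_ge0 ?invr_ge0 ?(ltW a0).
- under eq_integral do rewrite EFinM.
  have mAE : measurable_fun setT (fun w => (avg (fun i => Num.max (Z i w - B) 0))%:E).
    exact/measurable_EFinP.
  have AE0 w : 0 <= (avg (fun i => Num.max (Z i w - B) 0))%:E by rewrite lee_fin.
  have a'0 : 0 <= (a^-1 : R)%:E by rewrite lee_fin invr_ge0 ltW.
  rewrite ge0_integralZl//.
  apply: (@le_trans _ _ ((a^-1)%:E * a%:E)).
    by rewrite lee_wpmul2l//; exact: integral_average_le.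
  by rewrite -EFinM mulVf// gt_eqF.
- move=> w; rewrite mulrC ler_pdivrMr// => /le_trans; apply.
  rewrite /a mulrCA -expRD le_eqVlt; apply/orP; left; apply/eqP.
  by congr (_ * expR _)%R; ring.
Qed.

(** [Q] is the sum of four nonnegative variables of mean at most 1, one for each
    step of the chain from the average of [K] through those of [h], [g] and [phi]
    to the mean [mu] of [phi]. *)
Lemma coordinate_bound : exists (Q : T -> R) (mu : R),
  [/\ measurable_fun setT Q, (forall w, 0 <= Q w)%R,
      \int[P]_w (Q w)%:E <= 4,
      (0 <= mu)%R /\ mu%:E <= \int[P]_w f (subfamily X t0 w) &
      forall w, (Q w <= expR L ->
        #|{: inc_tuple n r}|%:R^-1 * \sum_(i : inc_tuple n r)
          K (subfamily X (val i) w, V (sg i) w) <=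
        4 * mu + 4 * (level 1 beta u L * L / (n %/ r)%:R) +
        2 * (level 4^-1 (beta / 2) u L * L / #|{: inc_tuple n r}|%:R) +
        (2 * excess_constant 1 beta 2 +
         excess_constant 4^-1 (beta / 2) (2 * expR 1)) * u * expR (- L))%R].
Proof.
have mXI i : measurable_fun setT (XI i) by exact: measurable_subfamily.
have mgI i : measurable_fun setT (fun w => g (XI i w)) by exact: mXt.
have mXV i : measurable_fun setT (fun w => (XI i w, VI i w)).
  by apply: measurable_fun_pair.
have mKI i : measurable_fun setT (fun w => K (XI i w, VI i w)).
  exact: (measurableT_comp mK).
have [Q2 [mQ2 Q20 Q21 HQ2]] := normalized_excess C1_gt0 mgI mean_excess1.
have [Q4 [mQ4 Q40 Q41 HQ4]] := normalized_excess C0_gt0 mKI mean_excess0.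
pose k : R := (n %/ r)%:R.
have k0 : (0 < k)%R by rewrite ltr0n divn_gt0.
have IR0 : (0 < #|{: I}|%:R :> R)%R by rewrite ltr0n.
(* Q1 compares phi with its mean, Q3 compares h with g; Q2 and Q4 are the
   excesses of g over phi and of K over h *)
pose Q1 w := expR (k / (2 * B1) * (avg (fun i => phi (XI i w)) - 2 * m)).
pose Q3 w := expR (\sum_(i : I) (h (XI i w, VI i w) - 2 * g (XI i w)) / (2 * B0)).
have Q11 : \int[P]_w (Q1 w)%:E <= 1.
  exact: (symmetric_average_mgf iX rn ut0 B1_gt0 mphi phi_bound sphi mE).
have Q31 : \int[P]_w (Q3 w)%:E <= 1.
  exact: (conditional_mgf_le1 iV XV (fun i : I => val i) isg B0_gt0 mh mg h_bound gjE).
have mQ1 : measurable_fun setT Q1.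
  have m1 : measurable_fun setT (fun w => avg (fun i => phi (XI i w))).
    by apply: measurable_avg => i; exact: mXt.
  have m2 : measurable_fun setT
      (fun w => k / (2 * B1) * (avg (fun i => phi (XI i w)) - 2 * m))%R.
    apply: measurable_funM; first exact: measurable_cst.
    by apply: measurable_funB => //; exact: measurable_cst.
  exact: (measurableT_comp (@measurable_expR R) m2).
have mQ3 : measurable_fun setT Q3.
  have m2 : measurable_fun setT (fun w =>
      \sum_(i : I) (h (XI i w, VI i w) - 2 * g (XI i w)) / (2 * B0))%R.
    apply: measurable_sum => i; apply: measurable_funM; last exact: measurable_cst.
    apply: measurable_funB; first exact: (measurableT_comp mh).
    by apply: measurable_funM => //; exact: measurable_cst.
  exact: (measurableT_comp (@measurable_expR R) m2).
have Q10 w : (0 <= Q1 w)%R by exact: expR_ge0.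
have Q30 w : (0 <= Q3 w)%R by exact: expR_ge0.
exists (fun w => Q1 w + Q2 w + (Q3 w + Q4 w))%R, m; split => //.
- by apply: measurable_funD; exact: measurable_funD.
- by move=> w; rewrite !addr_ge0.
- under eq_integral do rewrite !EFinD.
  have p1 w : 0 <= (Q1 w)%:E by rewrite lee_fin.
  have p2 w : 0 <= (Q2 w)%:E by rewrite lee_fin.
  have p3 w : 0 <= (Q3 w)%:E by rewrite lee_fin.
  have p4 w : 0 <= (Q4 w)%:E by rewrite lee_fin.
  have p12 w : 0 <= (Q1 w)%:E + (Q2 w)%:E by rewrite adde_ge0.
  have p34 w : 0 <= (Q3 w)%:E + (Q4 w)%:E by rewrite adde_ge0.
  have /measurable_EFinP e1 := mQ1. have /measurable_EFinP e2 := mQ2.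
  have /measurable_EFinP e3 := mQ3. have /measurable_EFinP e4 := mQ4.
  have e12 : measurable_fun setT (fun w => (Q1 w)%:E + (Q2 w)%:E).
    exact: emeasurable_funD.
  have e34 : measurable_fun setT (fun w => (Q3 w)%:E + (Q4 w)%:E).
    exact: emeasurable_funD.
  rewrite ge0_integralD// ge0_integralD// ge0_integralD//.
  apply: (@le_trans _ _ (1 + 1 + (1 + 1))); first by rewrite leeD// leeD.
  by rewrite -[leLHS]/((1 + 1 + (1 + 1))%:E) lee_fin; lra.
- split=> //; rewrite fine_ge0// integral_ge0// => w _.
  by rewrite lee_fin; case/andP: (phi_bound (subfamily X t0 w)).
move=> w HQ.
have := Q10 w; have := Q20 w; have := Q30 w; have := Q40 w => q4 q3 q2 q1.
have HQ2' : (Q2 w <= expR L)%R by lra.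
have HQ4' : (Q4 w <= expR L)%R by lra.
have HQ1 : (Q1 w <= expR L)%R by lra.
have HQ3 : (Q3 w <= expR L)%R by lra.
have {}HQ2 := HQ2 w HQ2'.
have {}HQ4 := HQ4 w HQ4'.
pose A := avg (fun i => K (XI i w, VI i w)).
pose H := avg (fun i => h (XI i w, VI i w)).
pose G := avg (fun i => g (XI i w)).
pose F := avg (fun i => phi (XI i w)).
have AH : (A <= H + C0 * u * expR (- L))%R.
  rewrite (le_trans _ (lerD (lexx H) HQ4))// -avgD; apply: le_avg => i.
  by rewrite min_add_excess.
have GF : (G <= F + C1 * u * expR (- L))%R.
  rewrite (le_trans _ (lerD (lexx F) HQ2))// -avgD; apply: le_avg => i.
  by rewrite min_add_excess.
have F_le : (F <= 2 * m + 2 * (B1 * L / k))%R.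
  move: HQ1; rewrite /Q1 -/F ler_expR => HF.
  have B10 := B1_gt0; rewrite -lerBlDl.
  have kB : (0 < k / (2 * B1))%R by rewrite divr_gt0// mulr_gt0.
  have -> : (2 * (B1 * L / k) = L / (k / (2 * B1)))%R by field; rewrite !gt_eqF.
  by rewrite ler_pdivlMr// [leLHS]mulrC.
have H_le : (H <= 2 * G + 2 * (B0 * L / #|{: I}|%:R))%R.
  have B20 : (0 < 2 * B0)%R by apply: mulr_gt0.
  move: HQ3; rewrite /Q3 ler_expR -mulr_suml ler_pdivrMr//.
  rewrite sumrB -mulr_sumr => HS.
  rewrite /H /G /avg mulrCA -lerBlDl -mulrBr.
  rewrite [leRHS](_ : _ = #|{: I}|%:R^-1 * (L * (2 * B0)))%R; last by field; rewrite gt_eqF.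
  by rewrite ler_wpM2l ?invr_ge0 ?ler0n.
change (A <= 4 * m + 4 * (B1 * L / k) + 2 * (B0 * L / #|{: I}|%:R) +
  (2 * C1 + C0) * u * expR (- L))%R.
have e : ((2 * C1 + C0) * u * expR (- L) =
    2 * (C1 * u * expR (- L)) + C0 * u * expR (- L))%R.
  by ring.
rewrite e; lra.
Qed.

End one_coordinate.

(** * Comparison with the announced bound *)

Section final_bound.
Context (R : realType).
Local Open Scope ring_scope.

(** The coefficients met in [deterministic_bound], added up. *)
Definition absolute_constant (beta : R) : R :=
  4 + (16 * 4 `^ beta^-1 + 2 * (2 * excess_constant 1 beta 2 +
       excess_constant 4^-1 (beta / 2) (2 * expR 1))) + 4 * 16 `^ (2 / beta).

Lemma absolute_constant_ge4 (beta : R) : 0 < beta -> 4 <= absolute_constant beta.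
Proof.
move=> b0; rewrite /absolute_constant.
have h1 : 0 < excess_constant 1 beta 2 by exact: excess_constant_gt0.
have h2 : 0 < excess_constant 4^-1 (beta / 2) (2 * expR 1).
  by apply: excess_constant_gt0; rewrite ?invr_gt0 ?divr_gt0 ?mulr_gt0 ?expR_gt0.
have h3 : 0 <= 4 `^ beta^-1 :> R by exact: powR_ge0.
have h4 : 0 <= 16 `^ (2 / beta) :> R by exact: powR_ge0.
lra.
Qed.

(** That is, [exp 1 <= 4], as the square of [exp (1 / 2) <= 2]. *)
Lemma ln4_ge1 : 1 <= ln 4 :> R.
Proof.
rewrite -[1 in leLHS](@expRK R) ler_ln ?posrE ?expR_gt0//.
have := @expR_half_le1D R 1; rewrite lexx ler01 => /(_ isT) h.
have -> : expR 1 = expR (1 / 2) * expR (1 / 2) :> R by rewrite -expRD; congr expR; lra.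
have := expR_gt0 (1 / 2 : R); nra.
Qed.

(** The number [n %/ r] of blocks is at least [n / (2 r)]. *)
Lemma leq_double_divn n r : (0 < r <= n)%N -> (n <= 2 * (n %/ r * r))%N.
Proof.
move=> /andP[r0 rn].
have r_le : (r <= n %/ r * r)%N by rewrite leq_pmull// divn_gt0.
by rewrite {1}(divn_eq n r) mul2n -addnn leq_add2l (leq_trans _ r_le)// ltnW// ltn_pmod.
Qed.

(** [coordinate_bound] at the scale [2 u] gives the left-hand side.  Since
    [ln n >= 1] and the exponents of [ln n] and [r] are nonnegative, these powers
    only enlarge the right-hand side, and [exp (- L) = 1 / (d n)] makes the last
    term smaller than the one in [r / n]. *)
Lemma deterministic_bound (beta u mu L C : R) (n d r N : nat) :
  0 < beta <= 1 -> 1 <= u -> 0 <= mu -> (4 <= n)%N -> (3 <= d)%N -> (2 <= r)%N ->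
  (r <= n)%N -> (0 < N)%N ->
  L = ln (d * n)%:R -> C = absolute_constant beta ->
  4 * mu + 4 * (level 1 beta (2 * u) L * L / (n %/ r)%:R) +
    2 * (level 4^-1 (beta / 2) (2 * u) L * L / N%:R) +
    (2 * excess_constant 1 beta 2 +
     excess_constant 4^-1 (beta / 2) (2 * expR 1)) * (2 * u) * expR (- L) <=
  4 * mu + C * n%:R^-1 * r%:R * L `^ (beta^-1 + 1) * ln n%:R `^ (beta^-1 - 1) * u +
    C * N%:R^-1 * r%:R `^ (3 / beta) * L `^ (2 / beta + 1) *
       ln n%:R `^ (2 / beta - 1) * u.
Proof.
move=> /andP[b0 b1] u1 mu0 n4 d3 r2 rn N0 LE CE.
have n_gt0 : (0 < n)%N by exact: leq_trans n4.
have d_gt0 : (0 < d)%N by exact: leq_trans d3.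
have r_gt0 : (0 < r)%N by exact: leq_trans r2.
have n0 : 0 < n%:R :> R by rewrite ltr0n.
have r0 : 1 <= r%:R :> R by rewrite ler1n.
have Nr0 : 0 < N%:R :> R by rewrite ltr0n.
have dn0 : 0 < (d * n)%:R :> R by rewrite ltr0n muln_gt0 d_gt0.
have lnn1 : 1 <= ln n%:R :> R.
  by apply: (le_trans ln4_ge1); rewrite ler_ln ?posrE// ler_nat.
have L1 : 1 <= L.
  by rewrite LE; apply: (le_trans lnn1); rewrite ler_ln ?posrE// ler_nat leq_pmull.
have L0 : 0 <= L by lra.
have p1 (x p : R) : 1 <= x -> 0 <= p -> 1 <= x `^ p.
  by move=> x1 p0; rewrite -(powRr0 x) ler_powR.
have bi1 : 1 <= beta^-1 by rewrite invr_ge1 ?unitfE ?gt_eqF.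
have bi2 : 2 / beta = 2 * beta^-1 by [].
have k0 : 0 < (n %/ r)%:R :> R by rewrite ltr0n divn_gt0.
have kinv : (n %/ r)%:R^-1 <= 2 * (n%:R^-1 * r%:R) :> R.
  rewrite -(ler_pM2l k0) mulfV ?gt_eqF//.
  rewrite -(ler_pM2l n0) mulr1.
  have -> : n%:R * ((n %/ r)%:R * (2 * (n%:R^-1 * r%:R))) = (2 * (n %/ r * r))%:R :> R.
    by rewrite !natrM; field; rewrite gt_eqF.
  rewrite ler_nat.
  apply: leq_double_divn.
  rewrite rn andbT.
  exact: r_gt0.
set C1 := excess_constant 1 beta 2.
set C0 := excess_constant 4^-1 _ _.
have C1_0 : 0 < C1 by exact: excess_constant_gt0.
have C0_0 : 0 < C0.
  by apply: excess_constant_gt0; rewrite ?invr_gt0 ?divr_gt0 ?mulr_gt0 ?expR_gt0.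
have lev1 : level 1 beta (2 * u) L * L = 2 * u * 4 `^ beta^-1 * L `^ (beta^-1 + 1).
  rewrite /level divr1 powRM// -[X in _ * X = _](powRr1 L0).
  by rewrite (@powRD _ L) ?(gt_eqF (lt_le_trans ltr01 L1)) ?implybT//; ring.
have lev0 : level 4^-1 (beta / 2) (2 * u) L * L =
    2 * u * 16 `^ (2 / beta) * L `^ (2 / beta + 1).
  rewrite /level invf_div (_ : 4 * L / 4^-1 = 16 * L); last by field.
  rewrite powRM//.
  rewrite -[X in _ * X = _](powRr1 L0).
  by rewrite (@powRD _ L) ?(gt_eqF (lt_le_trans ltr01 L1)) ?implybT//; ring.
have eL : expR (- L) <= n%:R^-1.
  by rewrite LE expRN lnK ?posrE// lef_pV2 ?posrE// ler_nat leq_pmull.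
rewrite lev1 lev0.
set c4 := 4 `^ beta^-1; set c16 := 16 `^ (2 / beta).
have CE' : C = 4 + (16 * c4 + 2 * (2 * C1 + C0)) + 4 * c16 by [].
have c40 : 0 <= c4 by exact: powR_ge0.
have c160 : 0 <= c16 by exact: powR_ge0.
have q1 : 1 <= L `^ (beta^-1 + 1) by apply: p1 => //; lra.
have q2 : 1 <= L `^ (2 / beta + 1) by apply: p1 => //; lra.
have l1 : 1 <= ln n%:R `^ (beta^-1 - 1) :> R by apply: p1 => //; lra.
have l2 : 1 <= ln n%:R `^ (2 / beta - 1) :> R by apply: p1 => //; lra.
have rr : 1 <= r%:R `^ (3 / beta) :> R.
  by apply: p1 => //; rewrite divr_ge0 ?(ltW b0).
move: q1 q2 l1 l2 rr.
set q := L `^ _; set q' := L `^ _; set l := ln _ `^ _; set l' := ln _ `^ _.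
set rb := r%:R `^ _ => q1 q2 l1 l2 rr.
have n'0 : 0 < n%:R^-1 :> R by rewrite invr_gt0.
have N'0 : 0 < N%:R^-1 :> R by rewrite invr_gt0.
move: kinv eL n'0 N'0.
set k' := (n %/ r)%:R^-1; set n' := n%:R^-1; set N' := N%:R^-1.
set e := expR (- L) => kinv eL n'0 N'0.
have u0 : 0 <= u by lra.
have q0 : 0 <= q by exact: le_trans q1.
have q'0 : 0 <= q' by exact: le_trans q2.
have l0 : 0 <= l by exact: le_trans l1.
have l'0 : 0 <= l' by exact: le_trans l2.
have rb0 : 0 <= rb by exact: le_trans rr.
have rR0 : 0 <= r%:R :> R by exact: le_trans r0.
have n'_ge0 := ltW n'0; have N'_ge0 := ltW N'0.
have D0 : 0 <= 2 * C1 + C0 by lra.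
have m1 : n' * r%:R * q * u <= n' * r%:R * q * l * u.
  by rewrite ler_wpM2r// ler_peMr// !mulr_ge0.
have m2 : n' * u <= n' * r%:R * q * l * u.
  by rewrite ler_wpM2r// -!mulrA ler_peMr// mulr_ege1// mulr_ege1.
have m3 : N' * q' * u <= N' * rb * q' * l' * u.
  by rewrite ler_wpM2r// -!mulrA ler_wpM2l// [rb * _]mulrCA ler_peMr// mulr_ege1.
have t1 : 4 * (2 * u * c4 * q * k') <= 16 * c4 * (n' * r%:R * q * l * u).
  apply: (@le_trans _ _ (16 * c4 * (n' * r%:R * q * u))); last first.
    by rewrite ler_wpM2l// mulr_ge0.
  have -> : 4 * (2 * u * c4 * q * k') = 8 * c4 * q * u * k' by ring.
  have -> : 16 * c4 * (n' * r%:R * q * u) = 8 * c4 * q * u * (2 * (n' * r%:R)) by ring.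
  by rewrite ler_wpM2l// !mulr_ge0.
have t2 : 2 * (2 * u * c16 * q' * N') <= 4 * c16 * (N' * rb * q' * l' * u).
  apply: (@le_trans _ _ (4 * c16 * (N' * q' * u))); last first.
    by rewrite ler_wpM2l// mulr_ge0.
  by rewrite le_eqVlt; apply/orP; left; apply/eqP; ring.
have t3 : (2 * C1 + C0) * (2 * u) * e <= 2 * (2 * C1 + C0) * (n' * r%:R * q * l * u).
  apply: (@le_trans _ _ (2 * (2 * C1 + C0) * (n' * u))); last first.
    by rewrite ler_wpM2l// mulr_ge0.
  have -> : 2 * (2 * C1 + C0) * (n' * u) = (2 * C1 + C0) * (2 * u) * n' by ring.
  by rewrite ler_wpM2l// !mulr_ge0.
have M1 : 0 <= n' * r%:R * q * l * u by rewrite !mulr_ge0.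
have M2 : 0 <= N' * rb * q' * l' * u by rewrite !mulr_ge0.
have -> : C * n' * r%:R * q * l * u = C * (n' * r%:R * q * l * u) by ring.
have -> : C * N' * rb * q' * l' * u = C * (N' * rb * q' * l' * u) by ring.
move: M1 M2 t1 t2 t3.
set X1 := n' * r%:R * q * l * u; set X2 := N' * rb * q' * l' * u => M1 M2 t1 t2 t3.
have T1 : (16 * c4 + 2 * (2 * C1 + C0)) * X1 <= C * X1.
  by rewrite ler_wpM2r// CE'; lra.
have T2 : 4 * c16 * X2 <= C * X2 by rewrite ler_wpM2r// CE'; lra.
lra.
Qed.

End final_bound.

(** * Union over the coordinates *)

(** One application of Markov's inequality to the sum of the [Q j] replaces a
    union bound. *)
Lemma markov_sum dT (T : measurableType dT) (R : realType) (P : probability T R)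
    (J : finType) (Q : J -> T -> R) (a c : R) (E : set T) : (0 < a)%R ->
  (forall j, measurable_fun setT (Q j)) -> (forall j w, 0 <= Q j w)%R ->
  (forall j, \int[P]_w (Q j w)%:E <= c%:E) ->
  measurable E -> (forall w, (forall j, (Q j w <= a)%R) -> E w) ->
  (1 - #|J|%:R * c / a)%:E <= P E.
Proof.
move=> a0 mQ Q0 Qc mE QE; pose q w := (\sum_j Q j w)%R.
have q0 w : (0 <= q w)%R by rewrite sumr_ge0.
have mq : measurable_fun setT q by exact: measurable_sum.
have mqE : measurable_fun setT (EFin \o q) by exact/measurable_EFinP.
have Iq : \int[P]_w (q w)%:E <= (#|J|%:R * c)%:E.
  under eq_integral do rewrite -sumEFin.
  rewrite ge0_integral_sum//.
  - apply: (@le_trans _ _ (\sum_(j : J) c%:E)); first exact: lee_sum.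
    by rewrite sumEFin lee_fin sumr_const -[(c *+ _)%R]mulr_natl.
  - by move=> j; exact/measurable_EFinP.
  - by move=> j w _; rewrite lee_fin.
pose bad := [set w | a%:E <= `|(q w)%:E|].
have mbad : measurable bad.
  rewrite -[X in measurable X]setTI; apply: emeasurable_fun_c_infty => //.
  exact: measurableT_comp.
have Pbad : a%:E * P bad <= (#|J|%:R * c)%:E.
  have := @le_integral_abse _ T R P setT measurableT (EFin \o q) a mqE a0.
  rewrite setTI => /le_trans; apply; apply: le_trans Iq.
  by under eq_integral do rewrite /= ger0_norm//.
have Pe : P bad = (fine (P bad))%:E by rewrite fineK ?fin_num_measure.
have p_le : (fine (P bad) <= #|J|%:R * c / a)%R.
  by move: Pbad; rewrite Pe -EFinM !lee_fin mulrC -ler_pdivlMr.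
apply: (@le_trans _ _ (P (~` bad))).
  rewrite probability_setC// Pe -[leRHS]/((1 - fine (P bad))%:E) lee_fin.
  by rewrite lerD2l lerN2.
apply: le_measure; rewrite ?inE.
- exact: measurableC.
- exact: mE.
- move=> w /= /negP; rewrite -ltNge abse_EFin ger0_norm// lte_fin => qa.
  apply: QE => j.
  apply: (le_trans _ (ltW qa)).
  by rewrite /q (bigD1 j)//= lerDl sumr_ge0.
Qed.

Theorem lemmaA6 (R : realType) (beta : R)
    (beta_gt0 : (0 < beta)%R) (beta_le1 : (beta <= 1)%R) :
  exists C : R, (0 < C)%R /\
  forall (n d r : nat) (n_ge4 : (4 <= n)%N) (d_ge3 : (3 <= d)%N)
    (r_ge2 : (2 <= r)%N) (r_le_n : (r <= n)%N)
    (dT : measure_display) (T : measurableType dT) (P : probability T R)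
    (dS : measure_display) (S : measurableType dS)
    (dS' : measure_display) (S' : measurableType dS')
    (X : 'I_n -> {RV P >-> S})
    (W : {RV P >-> S'}) (Wi : inc_tuple n r -> {RV P >-> S'})
    (F : r.-tuple S * S' -> d.-tuple R) (u : R),
  let XW := oapp Wi W in
  let X1r := subfamily X (first_indices r_le_n) in
  let f := mean_kernel F W in
  let b := psi_kernel F beta W in
  iid X -> iid XW -> independent_families X XW ->
  measurable_fun setT F -> symmetric_kernel F ->
  (forall (z : r.-tuple S * S') (j : 'I_d), (0 <= tnth (F z) j)%R) ->
  (1 <= u)%R ->
  (forall j : 'I_d, psi_norm P beta (fun w => b j (X1r w)) <= u%:E) ->
  (forall j : 'I_d, psi_norm P beta (fun w => f j (X1r w)) <= u%:E) ->
  (1 - 8 / n%:R)%R%:E <=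
  P [set w | max_average F X Wi w <=
      C%:E * \big[maxe/-oo]_(j < d) (\int[P]_w' f j (X1r w'))
      + (C * n%:R^-1 * r%:R * ln (d * n)%:R `^ (beta^-1 + 1)
           * ln n%:R `^ (beta^-1 - 1) * u)%R%:E
      + (C * #|{: inc_tuple n r}|%:R^-1 * r%:R `^ (3 / beta)
           * ln (d * n)%:R `^ (2 / beta + 1)
           * ln n%:R `^ (2 / beta - 1) * u)%R%:E].
Proof.
have C4 := absolute_constant_ge4 beta_gt0.
exists (absolute_constant beta); split; first exact: lt_le_trans C4.
move=> n d r n4 d3 r2 rn dT T P dS S dS' S' X W Wi F u XW X1r f b.
move=> iX iW XXW mF sF F0 u1 bu fu.
have beta01 : (0 < beta <= 1)%R by rewrite beta_gt0.
have n_gt0 : (0 < n)%N by exact: leq_trans n4.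
have d_gt0 : (0 < d)%N by exact: leq_trans d3.
have r_gt0 : (0 < r)%N by exact: leq_trans r2.
have dn0 : (0 < (d * n)%:R :> R)%R by rewrite ltr0n muln_gt0 d_gt0.
set L := ln (d * n)%:R; set C := absolute_constant beta.
have u2 : (0 < 2 * u)%R by rewrite mulr_gt0// (lt_le_trans _ u1).
have L0 : (0 < L)%R.
  rewrite ln_gt0// ltr1n (leq_trans _ (leq_pmull n d_gt0))//.
  exact: leq_trans n4.
have C0 : (0 < C)%R by exact: lt_le_trans C4.
pose K j (z : r.-tuple S * S') := tnth (F z) j.
have mK j : measurable_fun setT (K j).
  exact: (measurableT_comp (measurable_tnth j) mF).
have sK j : symmetric_kernel (K j) by move=> s x v; rewrite /K sF.
have K0 j z : (0 <= K j z)%R by exact: F0.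
have isg : injective (@Some (inc_tuple n r)) by move=> i i' [].
have ut0 : uniq (first_indices rn).
  by apply/tuple_uniqP => i i'; rewrite !tnth_mktuple => -[] /val_inj.
have fE j x : f j x = \int[P]_w (K j (x, XW None w))%:E.
  by rewrite /f /mean_kernel unlock.
have mf j : measurable_fun setT (f j).
  rewrite (funext (fE j)).
  apply: (measurable_kernel_integral (psi := fun z => (K j z)%:E)).
    exact/measurable_EFinP.
  by move=> z; rewrite lee_fin.
have bE j x : b j x = psi_norm P beta
    (fun w => (K j (x, XW None w))%:E - \int[P]_w (K j (x, XW None w))%:E).
  by rewrite -fE.
have mb j : measurable_fun setT (b j).
  by rewrite (funext (bE j)); apply: measurable_conditional_psi_norm => //; exact: ltW.
(* every scale above the norm is admissible, but perhaps not the norm itself *)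
have lt2u (x : \bar R) : x <= u%:E -> x < (2 * u)%:E.
  by move=> /le_lt_trans; apply; rewrite lte_fin; lra.
have f_orlicz j : \int[P]_w orlicz beta (2 * u)
    (\int[P]_w' (K j (X1r w, XW None w'))%:E) <= 2.
  under eq_integral do rewrite -fE.
  apply: psi_norm_lt_orlicz; [exact: ltW| |exact: lt2u].
  exact/(measurableT_comp (mf j))/measurable_subfamily.
have b_orlicz j : \int[P]_w orlicz beta (2 * u) (psi_norm P beta
    (fun w' => (K j (X1r w, XW None w'))%:E -
       \int[P]_w' (K j (X1r w, XW None w'))%:E)) <= 2.
  under eq_integral do rewrite -bE.
  apply: psi_norm_lt_orlicz; [exact: ltW| |exact: lt2u].
  exact/(measurableT_comp (mb j))/measurable_subfamily.
have HQ j := coordinate_bound iX iW XXW isg ut0 r_gt0 rn (mK j) (K0 j) (sK j)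
  beta01 u2 L0 (f_orlicz j) (b_orlicz j).
have [Q {}HQ] := choice HQ; have [mu {}HQ] := choice HQ.
have mQ j : measurable_fun setT (Q j) by have [] := HQ j.
have Q0 j w : (0 <= Q j w)%R by have [_ H _ _ _] := HQ j; exact: H.
have Q4 j : \int[P]_w (Q j w)%:E <= 4 by have [] := HQ j.
have mu0 j : (0 <= mu j)%R by have [_ _ _ [H _] _] := HQ j.
have mu_le j : (mu j)%:E <= \int[P]_w f j (X1r w).
  by under eq_integral do rewrite fE; have [_ _ _ [_ H] _] := HQ j.
have avgP w (c : \bar R) : max_average F X Wi w <= c <-> forall j : 'I_d,
    (#|{: inc_tuple n r}|%:R^-1 * \sum_(i : inc_tuple n r)
      K j (subfamily X (val i) w, XW (Some i) w))%R%:E <= c.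
  split=> [/bigmax_leP[_ H] j|H]; first exact: H.
  by apply/bigmax_leP; split=> [|j _]; [exact: leNye|exact: H].
have mset (c : \bar R) : measurable [set w | max_average F X Wi w <= c].
  rewrite (_ : mkset _ = \bigcap_(j in [set: 'I_d]) [set w |
  (#|{: inc_tuple n r}|%:R^-1 * \sum_(i : inc_tuple n r)
    K j (subfamily X (val i) w, XW (Some i) w))%R%:E <= c]).
  apply: fin_bigcap_measurable => // j _.
  rewrite -[X in measurable X]setTI; apply: emeasurable_fun_infty_c => //.
  apply/measurable_EFinP; apply: measurable_funM; first exact: measurable_cst.
  apply: measurable_sum => i; apply: (measurableT_comp (mK j)).
  by apply: measurable_fun_pair => //; exact: measurable_subfamily.
  apply/seteqP; split => w /= => [/avgP H j _|H]; first exact: H.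
  by apply/avgP => j; exact: H.
apply: (@le_trans _ _ (1 - #|'I_d|%:R * 4 / expR L)%:E).
  rewrite card_ord lnK ?posrE// natrM lee_fin lerD2l lerN2.
  rewrite invfM mulrACA mulfV ?mul1r; last by rewrite pnatr_eq0 -lt0n.
  by rewrite ler_wpM2r ?invr_ge0// ler_nat.
apply: (markov_sum (expR_gt0 L) mQ Q0 Q4); first exact: mset.
move=> w Qw; apply/avgP => j.
have [_ _ _ _ /(_ w (Qw j))] := HQ j.
have := deterministic_bound beta01 u1 (mu0 j) n4 d3 r2 rn
  (card_inc_tuple_gt0 rn) (erefl L) (erefl C).
set t1 := (C * n%:R^-1 * _ * _ * _ * _)%R.
set t2 := (C * _^-1 * _ * _ * _ * _)%R.
move=> H1 H2; have {H1}H2 := le_trans H2 H1.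
apply: (@le_trans _ _ (4 * mu j + t1 + t2)%:E); first by rewrite lee_fin.
rewrite 2!EFinD leeD2r// leeD2r//.
apply: (@le_trans _ _ (C%:E * (mu j)%:E)).
  by rewrite -EFinM lee_fin ler_wpM2r.
rewrite lee_wpmul2l// ?lee_fin ?(ltW C0)//.
apply: (le_trans (mu_le j)).
exact: (le_bigmax _ (fun j => \int[P]_w' f j (X1r w')) j).
Qed.
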